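(* For every integer $t\ge4$, every odd integer $\ell\ge5$ and every density $0<d\le 1/2$, we have $p(n;K_t,C_\ell,d)=n^{-2/(t-1)}$.
   Context: $K_t$ is the complete graph on $t$ vertices and $C_\ell$ the cycle of length $\ell$. A graph $G$ is $(H_1,H_2)$-Ramsey if every red/blue colouring of its edges contains a red copy of $H_1$ or a blue copy of $H_2$. The density of an $n$-vertex graph $G$ is $e(G)/\binom n2$. $G(n,p)$ is the binomial random graph on $[n]$ and $G_n\cup G(n,p)$ the union graph on $[n]$. The perturbed Ramsey threshold $p(n;H_1,H_2,d)$ is a function such that: (i) if $p=\omega(p(n;H_1,H_2,d))$ then for every sequence $(G_n)$ of $n$-vertex graphs of density at least $d$, $G_n\cup G(n,p)$ is $(H_1,H_2)$-Ramsey with high probability; (ii) if $p=o(p(n;H_1,H_2,d))$ then for some sequence $(G_n)$ of $n$-vertex graphs of density at least $d$, with high probability $G_n\cup G(n,p)$ is not $(H_1,H_2)$-Ramsey. *)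

(* Defs.v *)
From HB Require Import structures.
From mathcomp Require Import all_boot all_order all_algebra.
From mathcomp Require Import all_classical all_reals all_analysis.
Set Implicit Arguments. Unset Strict Implicit. Unset Printing Implicit Defensive.
Import Order.TTheory GRing.Theory Num.Theory.
Import numFieldNormedType.Exports.
Local Open Scope classical_set_scope.
Local Open Scope ring_scope.

Definition edges_of (n : nat) : {set {set 'I_n}} := [set e : {set 'I_n} | #|e| == 2%N].

Definition is_graph (n : nat) (G : {set {set 'I_n}}) : Prop :=
  G \subset edges_of n.

Definition K_graph (t : nat) : {set {set 'I_t}} := edges_of t.

Definition C_graph (l : nat) : {set {set 'I_l}} :=
  [set ([set i; ordS i] : {set 'I_l}) | i : 'I_l]%SET.

Definition contains_copy (k n : nat) (H : {set {set 'I_k}})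
  (S : {set {set 'I_n}}) : Prop :=
  exists f : 'I_k -> 'I_n, injective f /\ forall e, e \in H -> f @: e \in S.

Definition is_Ramsey (k1 k2 n : nat) (H1 : {set {set 'I_k1}})
  (H2 : {set {set 'I_k2}}) (G : {set {set 'I_n}}) : Prop :=
  forall Red : {set {set 'I_n}}, Red \subset G ->
    contains_copy H1 Red \/ contains_copy H2 (G :\: Red).

(* density of G is at least d:  e(G) >= d * binom(n,2),
   i.e. e(G)/binom(n,2) >= d whenever n >= 2. *)
Definition density_at_least (R : realType) (n : nat) (G : {set {set 'I_n}})
  (d : R) : Prop :=
  d * ('C(n, 2))%:R <= (#|G|)%:R.

Definition Gnp_prob (R : realType) (n : nat) (p : R)
  (A : {set {set 'I_n}} -> Prop) : R :=
  \sum_(E : {set {set 'I_n}} | (E \subset edges_of n) && `[< A E >])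
     p ^+ #|E| * (1 - p) ^+ (#|edges_of n| - #|E|).

Definition perturbed_Ramsey_threshold (R : realType) (k1 k2 : nat)
  (H1 : {set {set 'I_k1}}) (H2 : {set {set 'I_k2}}) (d : R)
  (f : nat -> R) : Prop :=
  (forall p : nat -> R, (forall n, 0 <= p n <= 1) ->
     (fun n => p n / f n) @ \oo --> +oo ->
     forall Gs : forall n : nat, {set {set 'I_n}},
       (forall n, is_graph (Gs n)) -> (forall n, density_at_least (Gs n) d) ->
       (fun n => Gnp_prob (p n) (fun E => is_Ramsey H1 H2 (Gs n :|: E)))
         @ \oo --> (1 : R))
  /\
  (forall p : nat -> R, (forall n, 0 <= p n <= 1) ->
     (fun n => p n / f n) @ \oo --> (0 : R) ->
     exists Gs : forall n : nat, {set {set 'I_n}},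
       (forall n, is_graph (Gs n)) /\ (forall n, density_at_least (Gs n) d) /\
       (fun n => Gnp_prob (p n) (fun E => ~ is_Ramsey H1 H2 (Gs n :|: E)))
         @ \oo --> (1 : R)).

(* Main.v *)
(* Put [L = n^2 p^(t-1)], so that [p] is above the threshold iff [L] tends to infinity.

   Below it, take [G] complete bipartite with balanced parts and colour [G] blue and the
   rest red: [G] has no odd cycle, and the expected number of copies of K_t in G(n,p) is
   at most [L^(t/2)].

   Above it, Janson's inequality and union bounds show that with high probability every
   linear-sized vertex set contains K_(t-1) in G(n,p), and contains C_l and K_(t-2) even after
   deleting any [delta n^2 p] edges. Consider a colouring without blue C_l.
   If [G] has many red edges, some red edge [uv] of G(n,p) has a linear set [W] of common
   red neighbours in [G], and [W] contains a red K_(t-2): for [t = 4] because G(n,p) has C_l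
   in [W]; for [t >= 5] because either few edges of G(n,p) in [W] are blue, or disjoint blue
   search trees in [W] have linearly large last levels with only red edges of G(n,p) between
   them.
   If [G] has few red edges, fix in advance a dense bipartite piece [(P, Q)] of [G] with [Q]
   in the neighbourhood of a vertex [z]; G(n,p) has a K_t inside [P]. If the piece stays
   dense after removal of its red edges, every edge of G(n,p) inside [P] must be red, since a
   blue one would close a blue C_l through [z]. Otherwise some vertex [v] has a linear red
   neighbourhood [W], in which the same argument finds a red K_(t-1). *)
Require Import Defs.
From HB Require Import structures.
From mathcomp Require Import all_boot all_order all_algebra.
From mathcomp Require Import all_classical all_reals all_analysis.
From mathcomp Require Import zify ring lra.
(* Makes the finite-set lemmas shadowed by [all_classical] visible again. *)
From mathcomp Require Import fintype finset.
Set Implicit Arguments. Unset Strict Implicit. Unset Printing Implicit Defensive.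
Import Order.TTheory GRing.Theory Num.Theory.
Import numFieldNormedType.Exports.
Local Open Scope ring_scope.

(** * Expectation over a random subset *)

(** The colouring is chosen after [G(n,p)] is drawn, so whatever is used inside a set depending on
    the colouring must hold for all linear-sized sets at once, and the union bound over them costs
    [exp (O(n))]. Janson's inequality leaves a failure probability [exp (- c Phi)], where [Phi]
    bounds from below the expected number of copies of every subgraph with an edge. This gives three
    tiers. For [K_t] only [Phi = sqrt L] is guaranteed, which may grow slower than [n]; so a [K_t]
    is found only in a set fixed beforehand, and [(P, Q)] is built from [G] alone. For [K_(t-1)],
    [Phi = n sqrt L] beats the union bound. For [K_(t-2)] and [C_l], [Phi = n^2 p] has the order of
    the number of edges of [G(n,p)], so even the choice of a small proportion of edges to delete is
    affordable. The search trees rest on expansion of sets of about [n p] vertices. Its failure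
    exponent [(n p)^2] must exceed a multiple of [n], so [n p^2] has to be large. This follows from
    large [L] only for [t >= 5]; hence the separate case [t = 4], where [K_(t-2)] is a single
    edge. *)

Section RandomSubset.
Variables (R : realType) (T : finType) (p : R).
Hypotheses (p0 : 0 <= p) (p1 : p <= 1).
Implicit Types (U E A B : {set T}) (f g : {set T} -> R).

Definition Ex U f : R :=
  \sum_(E : {set T} | E \subset U) p ^+ #|E| * (1 - p) ^+ (#|U| - #|E|) * f E.

Lemma set_elem_ind (P : {set T} -> Prop) :
  P set0 -> (forall x U, x \notin U -> P U -> P (x |: U)) -> forall U, P U.
Proof.
move=> P0 PU U; have [n] := ubnP #|U|; elim: n U => // n IH U.
have [->//|[x xU]] := set_0Vmem U.
rewrite -(setD1K xU) => hU; apply: PU; first by rewrite !inE eqxx.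
by apply: IH; move: hU; rewrite cardsU1 !inE eqxx.
Qed.

Lemma Ex_set0 f : Ex set0 f = f set0.
Proof.
rewrite /Ex (big_pred1 set0) => [|E]; last by rewrite subset0.
by rewrite cards0 !expr0 !mul1r.
Qed.

(** Conditioning on whether [x] is chosen; the correlation and moment facts below are inductions on
    [U] through this recursion. *)
Lemma Ex_setU1 x U f : x \notin U ->
  Ex (x |: U) f = p * Ex U (fun E => f (x |: E)) + (1 - p) * Ex U f.
Proof.
move=> xU; rewrite /Ex (bigID (fun E : {set T} => x \in E)) /=; congr (_ + _).
  rewrite big_distrr /= (reindex_onto (fun E => x |: E) (fun E => E :\ x)) /=; last first.
    by move=> E /andP[_ xE]; rewrite setD1K.
  apply: eq_big => [E|E /andP[/andP[]]].
    rewrite setU11 andbT; apply/andP/idP => [[EU /eqP <-]|EU].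
      by rewrite subDset.
    by rewrite setUS // setU1K // (contra (subsetP EU x) xU).
  move=> EU _ /eqP EE.
  have xE : x \notin E by rewrite -EE !inE eqxx.
  by rewrite !cardsU1 xE xU /= !add1n subSS exprS !mulrA.
rewrite big_distrr /=; apply: eq_big => [E|E].
  apply/andP/idP => [[EU xE]|EU].
    apply/subsetP => y yE; have := subsetP EU y yE; rewrite !inE.
    by case: eqP => // yx; rewrite yx (negbTE xE) in yE.
  by rewrite (subset_trans EU) ?subsetUr // (contra (subsetP EU x) xU).
move=> /andP[EU xE]; rewrite cardsU1 xU add1n subSn; last first.
  apply: subset_leq_card; apply/subsetP => y yE; have := subsetP EU y yE; rewrite !inE.
  by case: eqP => // yx; rewrite yx (negbTE xE) in yE.
by rewrite exprS; ring.
Qed.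

Lemma eq_Ex U f g : (forall E, E \subset U -> f E = g E) -> Ex U f = Ex U g.
Proof. by move=> fg; apply: eq_bigr => E EU; rewrite fg. Qed.

Lemma ExZ U c f : Ex U (fun E => c * f E) = c * Ex U f.
Proof. by rewrite /Ex big_distrr /=; apply: eq_bigr => E _; rewrite mulrCA. Qed.

Lemma ExD U f g : Ex U (fun E => f E + g E) = Ex U f + Ex U g.
Proof. by rewrite /Ex -big_split /=; apply: eq_bigr => E _; rewrite mulrDr. Qed.

Lemma ExB U f g : Ex U (fun E => f E - g E) = Ex U f - Ex U g.
Proof. by rewrite /Ex -sumrB; apply: eq_bigr => E _; rewrite mulrBr. Qed.

Lemma Ex_sum U (I : Type) (r : seq I) (P : pred I) (F : I -> {set T} -> R) :
  Ex U (fun E => \sum_(i <- r | P i) F i E) = \sum_(i <- r | P i) Ex U (F i).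
Proof.
rewrite /Ex exchange_big /=; apply: eq_bigr => E _.
by rewrite big_distrr.
Qed.

Lemma le_Ex U f g : (forall E, E \subset U -> f E <= g E) -> Ex U f <= Ex U g.
Proof.
move=> fg; apply: ler_sum => E EU; apply: ler_wpM2l; last exact: fg.
by rewrite mulr_ge0 // exprn_ge0 // subr_ge0.
Qed.

Lemma Ex_ge0 U f : (forall E, E \subset U -> 0 <= f E) -> 0 <= Ex U f.
Proof.
move=> f0; apply: sumr_ge0 => E EU; rewrite mulr_ge0 ?f0 // mulr_ge0 // exprn_ge0 //.
by rewrite subr_ge0.
Qed.

Lemma Ex_cst U c : Ex U (fun=> c) = c.
Proof.
elim/set_elem_ind: U => [|x U xU IH]; first by rewrite Ex_set0.
by rewrite Ex_setU1 // IH; ring.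
Qed.

(** Harris's inequality in its negative form. After the induction hypothesis the surplus is
    [p * (1 - p) * ((f1 - f0) * (g0 - g1))], whose factors are nonnegative by monotonicity. *)
Lemma Ex_harris U f g :
  (forall A B, A \subset B -> f A <= f B) -> (forall A B, A \subset B -> g B <= g A) ->
  Ex U (fun E => f E * g E) <= Ex U f * Ex U g.
Proof.
elim/set_elem_ind: U f g => [|x U xU IH] f g fi gd; first by rewrite !Ex_set0.
rewrite !Ex_setU1 //.
set f1 := Ex U (fun E => f (x |: E)); set f0 := Ex U f.
set g1 := Ex U (fun E => g (x |: E)); set g0 := Ex U g.
have h1 : Ex U (fun E => f (x |: E) * g (x |: E)) <= f1 * g1.
  by apply: IH => A B AB; [apply: fi|apply: gd]; apply: setUS.
have h0 : Ex U (fun E => f E * g E) <= f0 * g0 by apply: IH.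
have f01 : f0 <= f1 by apply: le_Ex => E _; apply/fi/subsetUr.
have g10 : g1 <= g0 by apply: le_Ex => E _; apply/gd/subsetUr.
apply: (@le_trans _ _ (p * (f1 * g1) + (1 - p) * (f0 * g0))).
  by apply: lerD; apply: ler_wpM2l; rewrite ?subr_ge0.
rewrite -subr_ge0.
have -> : (p * f1 + (1 - p) * f0) * (p * g1 + (1 - p) * g0)
   - (p * (f1 * g1) + (1 - p) * (f0 * g0)) = p * (1 - p) * ((f1 - f0) * (g0 - g1)) by ring.
by rewrite !mulr_ge0 // subr_ge0.
Qed.

(** [f] looks at [E] inside [A] and [g] outside it, so each new element enters only one factor. *)
Lemma Ex_indep U A f g :
  (forall E, f E = f (E :&: A)) -> (forall E, g E = g (E :\: A)) ->
  Ex U (fun E => f E * g E) = Ex U f * Ex U g.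
Proof.
elim/set_elem_ind: U f g => [|x U xU IH] f g fA gA; first by rewrite !Ex_set0.
rewrite !Ex_setU1 //; have [xA|xA] := boolP (x \in A).
  have gx : (fun E => g (x |: E)) = g.
    apply: funext => E; rewrite gA [RHS]gA; congr g; apply/setP => y; rewrite !inE.
    by case: eqP => // ->; rewrite xA.
  have fx E : f (x |: E) = f (x |: (E :&: A)).
    rewrite fA [RHS]fA; congr f; apply/setP => y; rewrite !inE.
    by case: (y \in A); rewrite ?andbF // !andbT.
  rewrite (IH f g) // -/(Ex U).
  have -> : Ex U (fun E => f (x |: E) * g (x |: E)) = Ex U (fun E => f (x |: E) * g E).
    by apply: eq_Ex => E _; rewrite -[in RHS]gx.
  by rewrite (IH (fun E => f (x |: E)) g) // gx; ring.
have fx : (fun E => f (x |: E)) = f.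
  apply: funext => E; rewrite fA [RHS]fA; congr f; apply/setP => y; rewrite !inE.
  by case: eqP => // ->; rewrite (negbTE xA) !andbF.
have gx E : g (x |: E) = g (x |: (E :\: A)).
  rewrite gA [RHS]gA; congr g; apply/setP => y; rewrite !inE.
  by case: (y \in A); rewrite ?andbF.
rewrite (IH f g) //.
have -> : Ex U (fun E => f (x |: E) * g (x |: E)) = Ex U (fun E => f E * g (x |: E)).
  by apply: eq_Ex => E _; rewrite -[in RHS]fx.
by rewrite (IH f (fun E => g (x |: E))) // fx; ring.
Qed.

Lemma Ex_sup U A : A \subset U -> Ex U (fun E => (A \subset E)%:R) = p ^+ #|A|.
Proof.
elim/set_elem_ind: U A => [|x U xU IH] A.
  by rewrite subset0 => /eqP ->; rewrite Ex_set0 sub0set cards0.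
move=> AU; rewrite Ex_setU1 //; have [xA|xA] := boolP (x \in A).
  have -> : Ex U (fun E => (A \subset x |: E)%:R) = p ^+ #|A :\ x|.
    rewrite -IH; last by rewrite subDset.
    by apply: eq_Ex => E _; rewrite subDset.
  rewrite [X in _ + _ * X](_ : _ = 0) ?mulr0 ?addr0.
    by rewrite -exprS [in RHS](cardsD1 x) xA.
  rewrite -[RHS](Ex_cst U); apply: eq_Ex => E EU.
  case: (boolP (A \subset E)) => // AE.
  by rewrite (subsetP EU x (subsetP AE x xA)) in xU.
have AU' : A \subset U.
  apply/subsetP => y yA; have := subsetP AU y yA; rewrite !inE.
  by case: eqP => // yx; rewrite yx (negbTE xA) in yA.
rewrite IH // [X in p * X](_ : _ = p ^+ #|A|); first by ring.
rewrite -IH //; apply: eq_Ex => E _; congr (nat_of_bool _)%:R.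
apply/idP/idP => [AE|AE]; last by rewrite (subset_trans AE) ?subsetUr.
apply/subsetP => y yA; have := subsetP AE y yA; rewrite !inE.
by case: eqP => // yx; rewrite yx (negbTE xA) in yA.
Qed.

(** Generating function of a binomial variable; it serves the tail bound [Pr_card_ge] and, at
    [p = 1/2], the counting of subsets. *)
Lemma Ex_expr_card U A (y : R) : A \subset U ->
  Ex U (fun E => y ^+ #|E :&: A|) = (1 - p + p * y) ^+ #|A|.
Proof.
elim/set_elem_ind: U A => [|x U xU IH] A.
  by rewrite subset0 => /eqP ->; rewrite Ex_set0 set0I cards0.
move=> AU; rewrite Ex_setU1 //; have [xA|xA] := boolP (x \in A).
  have hU : A :\ x \subset U by rewrite subDset.
  have e1 : Ex U (fun E => y ^+ #|(x |: E) :&: A|) = y * (1 - p + p * y) ^+ #|A :\ x|.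
    rewrite -IH // -ExZ; apply: eq_Ex => E EU; rewrite -exprS; congr (_ ^+ _).
    rewrite (cardsD1 x) !inE eqxx xA add1n; congr _.+1.
    apply: eq_card => z; rewrite !inE; case: eqP => //= _; by rewrite andbC.
  have e2 : Ex U (fun E => y ^+ #|E :&: A|) = (1 - p + p * y) ^+ #|A :\ x|.
    rewrite -IH //; apply: eq_Ex => E EU; congr (_ ^+ _).
    apply: eq_card => z; rewrite !inE; case: eqP => //= ->.
    by rewrite (negbTE (contra (subsetP EU x) xU)).
  by rewrite e1 e2 [in RHS](cardsD1 x) xA add1n exprS; ring.
have AU' : A \subset U.
  apply/subsetP => z zA; have := subsetP AU z zA; rewrite !inE.
  by case: eqP => // zx; rewrite zx (negbTE xA) in zA.
rewrite IH // [X in p * X](_ : _ = (1 - p + p * y) ^+ #|A|); first by ring.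
rewrite -IH //; apply: eq_Ex => E _; congr (_ ^+ _); apply: eq_card => z; rewrite !inE.
by case: eqP => // ->; rewrite (negbTE xA) !andbF.
Qed.

Lemma Ex_le_witness U f c : Ex U f <= c -> exists2 E : {set T}, E \subset U & f E <= c.
Proof.
move=> fc; apply: contrapT => no.
(* There are finitely many sets, so the minimum of [f] exceeds [c] by a uniform gap. *)
have [e e0 he] : exists2 e : R, 0 < e & forall E : {set T}, E \subset U -> c + e <= f E.
  have ne : (set0 : {set T}) \subset U by exact: sub0set.
  pose m := f (@Order.arg_min _ R _ set0 (fun E : {set T} => E \subset U) f).
  have mle E : E \subset U -> m <= f E.
    by move=> EU; rewrite /m; case: arg_minP => // i _ /(_ E EU).
  exists (m - c) => [|E EU]; last by rewrite addrC subrK mle.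
  rewrite subr_gt0 ltNge; apply/negP => mc; apply: no.
  by rewrite /m in mc; move: mc; case: arg_minP => // i iU _ ic; exists i.
have : Ex U (fun=> c + e) <= Ex U f by apply: le_Ex.
rewrite Ex_cst => h; have := le_trans h fc; lra.
Qed.

Definition Pr U (A : {set T} -> Prop) : R := Ex U (fun E => `[< A E >]%:R).

Lemma Pr_le U (A B : {set T} -> Prop) :
  (forall E, E \subset U -> A E -> B E) -> Pr U A <= Pr U B.
Proof.
move=> AB; apply: le_Ex => E EU; rewrite ler_nat; case: asboolP => // /AB h.
by rewrite asboolT //; apply: h.
Qed.

Lemma Pr_ge0 U (A : {set T} -> Prop) : 0 <= Pr U A.
Proof. by apply: Ex_ge0 => E _; rewrite ler0n. Qed.

Lemma Pr_le1 U (A : {set T} -> Prop) : Pr U A <= 1.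
Proof. by rewrite -[leRHS](Ex_cst U); apply: le_Ex => E _; rewrite lern1 leq_b1. Qed.

Lemma PrC U (A : {set T} -> Prop) : Pr U (fun E => ~ A E) = 1 - Pr U A.
Proof.
rewrite -[1](Ex_cst U) -ExB; apply: eq_Ex => E _.
by rewrite asbool_neg; case: asboolP; rewrite ?subrr ?subr0.
Qed.

Lemma Pr_or U (A B : {set T} -> Prop) : Pr U (fun E => A E \/ B E) <= Pr U A + Pr U B.
Proof.
rewrite -ExD; apply: le_Ex => E _; rewrite -natrD ler_nat.
by case: asboolP => // -[|] h; rewrite (asboolT h) // addnC.
Qed.

Lemma Pr_exists U (I : finType) (P : pred I) (A : I -> {set T} -> Prop) :
  Pr U (fun E => exists2 i, P i & A i E) <= \sum_(i | P i) Pr U (A i).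
Proof.
rewrite -Ex_sum; apply: le_Ex => E _; case: asboolP => [[i Pi Ai]|_]; last first.
  by apply: sumr_ge0 => i _; rewrite ler0n.
rewrite (bigD1 i) //= asboolT // lerDl; apply: sumr_ge0 => j _; exact: ler0n.
Qed.

(** Exponential Markov inequality with base [y = exp (1/2)]; as [y <= 2], the moment is at most
    [(1 + p) ^ #|A| <= exp (p #|A|)]. *)
Lemma Pr_card_ge U A (x : R) : A \subset U ->
  Pr U (fun E => x <= #|E :&: A|%:R) <= expR (p * #|A|%:R - x / 2).
Proof.
move=> AU; pose y : R := expR (2^-1).
have y2 : y <= 2.
  have h := expR_ge1Dx (- 2^-1 : R).
  have hy : 0 < y by exact: expR_gt0.
  have : y * expR (- 2^-1) = 1 :> R by rewrite -expRD subrr expR0.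
  nra.
have H : Pr U (fun E => x <= #|E :&: A|%:R) <=
         Ex U (fun E => expR (- (x / 2)) * y ^+ #|E :&: A|).
  apply: le_Ex => E _; rewrite -expRM_natl -expRD.
  case: asboolP => [h|_]; last exact: expR_ge0.
  by rewrite -[leLHS]expR0 ler_expR; lra.
apply: (le_trans H); rewrite ExZ Ex_expr_card //.
rewrite [_ - x / 2]addrC expRD; apply: ler_wpM2l; first exact: expR_ge0.
rewrite [p * #|A|%:R]mulrC expRM_natl; apply: lerXn2r; rewrite ?nnegrE ?expR_ge0 //.
  by rewrite addr_ge0 ?mulr_ge0 ?expR_ge0 // subr_ge0.
apply: le_trans (expR_ge1Dx _); have := ler_wpM2l p0 y2; lra.
Qed.

End RandomSubset.

(** * Janson's inequality *)

Section Janson.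
Variables (R : realType) (T I : finType) (p : R) (U : {set T}) (S : I -> {set T}).
Hypotheses (p0 : 0 <= p) (p1 : p <= 1) (SU : forall i, S i \subset U).

Let meets i j := (i != j) && (S i :&: S j != set0).

(* Boppana and Spencer's argument: condition on the events one at a time. *)
Lemma janson_seq (s : seq I) : uniq s ->
  Pr p U (fun E => forall i, i \in s -> ~~ (S i \subset E)) <=
  expR (- (\sum_(i <- s) p ^+ #|S i|)
        + \sum_(i <- s) \sum_(j <- s | meets i j) p ^+ #|S i :|: S j|).
Proof.
elim: s => [_|i s IH /=/andP[is_ us]].
  by rewrite !big_nil oppr0 addr0 expR0 Pr_le1.
pose N (E : {set T}) := forall j, j \in s -> ~~ (S j \subset E).
(* [C] concerns only the sets disjoint from [S i], so it is independent of [S i \subset E]. *)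
pose C (E : {set T}) := forall j, j \in s -> S j :&: S i == set0 -> ~~ (S j \subset E).
(* By a union bound over the [S j] meeting [S i], and Harris, [N] and [S i \subset E] hold together
   with probability at least [b * Pr p U C]. *)
pose b := p ^+ #|S i| - \sum_(j <- s | meets i j) p ^+ #|S i :|: S j|.
have NC : Pr p U N <= Pr p U C by apply: Pr_le => // E _ hN j /hN.
have step : Pr p U (fun E => forall j, j \in i :: s -> ~~ (S j \subset E))
    <= Pr p U N - b * Pr p U C.
  have -> : b * Pr p U C = Ex p U (fun E => (S i \subset E)%:R * `[< C E >]%:R)
     - \sum_(j <- s | meets i j) p ^+ #|S i :|: S j| * Pr p U C.
    rewrite /b mulrBl big_distrl /=; congr (_ - _).
    rewrite (@Ex_indep _ _ _ U (S i)) ?Ex_sup // => E.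
      by rewrite subsetI subxx andbT.
    congr (nat_of_bool _)%:R; apply: asbool_equiv_eq.
    split=> h j js ji; move: (h j js ji); apply: contra => hj.
      exact: subset_trans hj (subsetDl _ _).
    by rewrite subsetD hj -setI_eq0.
  have h : \sum_(j <- s | meets i j) Ex p U (fun E => (S i :|: S j \subset E)%:R * `[< C E >]%:R)
      <= \sum_(j <- s | meets i j) p ^+ #|S i :|: S j| * Pr p U C.
    apply: ler_sum => j _; rewrite -(@Ex_sup _ _ p U (S i :|: S j)); last by rewrite subUset !SU.
    apply: Ex_harris => // A B AB.
      rewrite ler_nat; case: (boolP (_ \subset A)) => // hA.
      by rewrite (subset_trans hA AB).
    rewrite ler_nat; case: asboolP => // hB; rewrite asboolT // => k ks ki.
    by apply: contra (hB k ks ki) => hk; apply: subset_trans AB.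
  suff : Pr p U (fun E => forall j, j \in i :: s -> ~~ (S j \subset E)) <= Pr p U N -
     (Ex p U (fun E => (S i \subset E)%:R * `[< C E >]%:R)
      - \sum_(j <- s | meets i j) Ex p U (fun E => (S i :|: S j \subset E)%:R * `[< C E >]%:R)) by lra.
  rewrite -Ex_sum -!ExB; apply: le_Ex => // E EU.
  case: (asboolP (N E)) => hN; last first.
    rewrite asboolF; last by move=> h'; apply: hN => j js; apply: h'; rewrite inE js orbT.
    case: (boolP (S i \subset E)) => hi; last first.
      rewrite mul0r !sub0r opprK; apply: sumr_ge0 => j _; rewrite mulr_ge0 ?ler0n //.
    case: asboolP => hC; last first.
      rewrite mulr0 sub0r opprB subr0.
      by apply: sumr_ge0 => j _; rewrite mulr0.
    have [j js hj] : exists2 j, j \in s & S j \subset E.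
      apply: contrapT => no; apply: hN => j js; apply/negP => hj; apply: no.
      by exists j.
    have ij : meets i j.
      apply/andP; split; first by apply: contraNneq is_ => ->.
      by rewrite setIC; apply/negP => /(hC j js); rewrite hj.
    rewrite mul1r sub0r opprB subr_ge0 (big_rem j) //= ij subUset hi hj mulr1.
    by rewrite lerDl; apply: sumr_ge0 => k _; rewrite mulr_ge0 ?ler0n.
  have hC : C E by move=> j js _; apply: hN.
  rewrite (asboolT hC) mulr1; under eq_bigr do rewrite mulr1.
  case: (boolP (S i \subset E)) => hi.
    rewrite asboolF; last by move=> /(_ i); rewrite inE eqxx hi => /(_ isT).
    rewrite opprB addrCA subrr addr0; apply: sumr_ge0 => j _; exact: ler0n.
  rewrite sub0r opprK -[leLHS]addr0; apply: lerD; last by apply: sumr_ge0 => j _; exact: ler0n.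
  by rewrite lern1 leq_b1.
have step2 : Pr p U (fun E => forall j, j \in i :: s -> ~~ (S j \subset E))
    <= Pr p U N * expR (- b).
  apply: (@le_trans _ _ (Pr p U N * (1 - b))); last first.
    by apply: ler_wpM2l; [exact: Pr_ge0|exact: expR_ge1Dx].
  (* For [b < 0] the factor [1 - b] exceeds 1, and it is enough to forget [i]. *)
  have [b0|b0] := lerP 0 b.
    by apply: (le_trans step); have := ler_wpM2l b0 NC; lra.
  apply: (@le_trans _ _ (Pr p U N)).
    by apply: Pr_le => // E _ h j js; apply: h; rewrite inE js orbT.
  have := Pr_ge0 p0 p1 U N; nra.
apply: (le_trans step2); apply: (le_trans (ler_wpM2r (expR_ge0 _) (IH us))).
rewrite -expRD ler_expR !big_cons /b.
have -> : meets i i = false by rewrite /meets eqxx.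
have h : \sum_(i0 <- s) \sum_(j <- s | meets i0 j) p ^+ #|S i0 :|: S j| <=
   \sum_(i0 <- s) \sum_(j <- i :: s | meets i0 j) p ^+ #|S i0 :|: S j|.
  apply: ler_sum => k _; rewrite big_cons; case: ifP => // _.
  by rewrite lerDr exprn_ge0.
lra.
Qed.

(* [janson_seq] for a subfamily of [F] that does at least as well as a [q]-random one. *)
Lemma janson (F : {set I}) (q : R) : 0 <= q <= 1 ->
  Pr p U (fun E => forall i, i \in F -> ~~ (S i \subset E)) <=
  expR (- (q * \sum_(i in F) p ^+ #|S i|)
        + q ^+ 2 * \sum_(i in F) \sum_(j in F | meets i j) p ^+ #|S i :|: S j|).
Proof.
move=> /andP[q0 q1].
pose f (J : {set I}) : R := - (\sum_(i in J) p ^+ #|S i|)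
        + \sum_(i in J) \sum_(j in J | meets i j) p ^+ #|S i :|: S j|.
have [J JF hJ] : exists2 J : {set I}, J \subset F & f J <=
   - (q * \sum_(i in F) p ^+ #|S i|)
        + q ^+ 2 * \sum_(i in F) \sum_(j in F | meets i j) p ^+ #|S i :|: S j|.
  apply: (Ex_le_witness q0 q1).
  have -> : Ex q F f = Ex q F (fun J => - 1 * (\sum_(i in F) p ^+ #|S i| * ([set i] \subset J)%:R)
     + \sum_(i in F) \sum_(j in F | meets i j) p ^+ #|S i :|: S j| * ([set i; j] \subset J)%:R).
    apply: eq_Ex => J JF; rewrite /f mulN1r; congr (- _ + _).
      rewrite [RHS](bigID (mem J)) /= [X in _ + X]big1 ?addr0.
        apply: eq_big => [i|i iJ]; last by rewrite sub1set iJ mulr1.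
        by case: (boolP (i \in J)) => [/(subsetP JF) ->|]; rewrite ?andbF.
      by move=> i /andP[_ iJ]; rewrite sub1set (negbTE iJ) mulr0.
    rewrite [RHS](bigID (mem J)) /= [X in _ + X]big1 ?addr0; last first.
      move=> i /andP[_ iJ]; rewrite big1 // => j _.
      by rewrite subUset sub1set (negbTE iJ) mulr0.
    apply: eq_big => [i|i iJ].
      by case: (boolP (i \in J)) => [/(subsetP JF) ->|]; rewrite ?andbF.
    rewrite [RHS](bigID (mem J)) /= [X in _ + X]big1 ?addr0; last first.
      by move=> j /andP[_ jJ]; rewrite subUset !sub1set (negbTE jJ) andbF mulr0.
    apply: eq_big => [j|j /andP[jJ _]]; last by rewrite subUset !sub1set iJ jJ mulr1.
    by case: (boolP (j \in J)) => [/(subsetP JF) ->|]; rewrite ?andbF ?andbT.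
  rewrite ExD ExZ !Ex_sum mulN1r; apply: lerD.
    rewrite lerN2 big_distrr /=; apply: ler_sum => i iF.
    by rewrite ExZ Ex_sup ?sub1set // cards1 expr1 mulrC.
  rewrite big_distrr /=; apply: ler_sum => i iF; rewrite Ex_sum big_distrr /=.
  apply: ler_sum => j /andP[jF /andP[ij _]].
  by rewrite ExZ Ex_sup ?subUset ?sub1set ?iF // cards2 ij mulrC.
apply: (@le_trans _ _ (Pr p U (fun E => forall i, i \in enum J -> ~~ (S i \subset E)))).
  by apply: Pr_le => // E _ h i; rewrite mem_enum => /(subsetP JF); apply: h.
apply: (le_trans (janson_seq (enum_uniq _))); rewrite ler_expR; apply: le_trans hJ.
rewrite /f !big_enum /=; apply: lerD => //; apply: ler_sum => i _.
by rewrite big_enum_cond.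
Qed.
End Janson.

(** * Copies of a fixed graph in G(n,p) *)

Section Copies.
Variables (k n : nat) (H : {set {set 'I_k}}).
Hypothesis HE : is_graph H.
Implicit Types (f g : {ffun 'I_k -> 'I_n}) (J : {set 'I_k}).

Definition copy f : {set {set 'I_n}} := [set f @: e | e : {set 'I_k} in H].
Definition induced J : {set {set 'I_k}} := [set e in H | e \subset J].

Lemma card_familyE (aT rT : finType) (F : aT -> pred rT) :
  #|family F| = (\prod_i #|F i|)%N.
Proof. by rewrite card_family foldrE big_image. Qed.

Lemma copy_sub f : injective f -> copy f \subset edges_of n.
Proof.
move=> fi; apply/subsetP => _ /imsetP[e eH ->]; rewrite inE card_imset //.
by have := subsetP HE e eH; rewrite inE.
Qed.

Lemma card_copy f : injective f -> #|copy f| = #|H|.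
Proof. by move=> fi; rewrite card_imset //; apply: imset_inj. Qed.

Lemma card_prescribed J (h : 'I_k -> 'I_n) :
  #|[set f : {ffun 'I_k -> 'I_n} | [forall i in J, f i == h i]]| = (n ^ (k - #|J|))%N.
Proof.
have -> : #|[set f : {ffun 'I_k -> 'I_n} | [forall i in J, f i == h i]]| =
    #|family (fun i => if i \in J then pred1 (h i) else predT)|.
  apply: eq_card => f; rewrite inE; apply/forall_inP/familyP => hf i.
    by case: ifP => // /hf.
  by move=> iJ; have := hf i; rewrite iJ.
rewrite card_familyE (bigID (mem J)) /= big1 ?mul1n => [|i ->]; last by rewrite card1.
rewrite (eq_bigr (fun=> n)) => [|i /negbTE->]; last by rewrite cardT size_enum_ord.
rewrite prod_nat_const; congr (_ ^ _)%N.
have := cardC (mem J); rewrite card_ord => hJ.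
have -> : #|(fun i => i \notin J)| = #|[predC mem J]| by apply: eq_card.
apply/eqP; rewrite -(eqn_add2l #|J|) [X in X == _]hJ subnKC //.
by have := max_card (mem J); rewrite card_ord.
Qed.

(** An edge shared by two copies has both ends in the image of [g], so it is the image of an edge of
    [H] inside the overlap. *)
Lemma copyI_sub f g : injective f ->
  copy f :&: copy g \subset [set f @: e | e : {set 'I_k} in induced [set i | f i \in codom g]].
Proof.
move=> fi; apply/subsetP => _ /setIP[/imsetP[e eH ->] /imsetP[e' _ ee']].
apply: imset_f; rewrite inE eH; apply/subsetP => i ie; rewrite inE.
have : f i \in g @: e' by rewrite -ee' imset_f.
by case/imsetP => j _ ->; apply: codom_f.
Qed.

(* The factor [2 ^ k * k ^ k] counts the ways [(J, s)] in which two copies [f] and [g]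
   can overlap: [J] is the part of [f] inside [g], and [f i = g (s i)] on [J]. *)
Lemma copies_janson (R : realType) (p c Phi : R) (F : {set {ffun 'I_k -> 'I_n}}) :
  0 < p -> p <= 1 -> 0 < c -> c <= 1 -> 0 < Phi -> H != set0 ->
  (forall J, induced J != set0 -> Phi <= n%:R ^+ #|J| * p ^+ #|induced J|) ->
  {in F, forall f, injective f} -> c * n%:R ^+ k <= #|F|%:R ->
  Pr p (edges_of n) (fun E => forall f, f \in F -> ~~ (copy f \subset E)) <=
  expR (- (c ^+ 2 * Phi / (4 * (2 ^ k * k ^ k)%:R))).
Proof.
move=> p0 p1 c0 c1 Phi0 H0 hPhi Finj Fc.
have p0' := ltW p0.
have arith (a b c' d : nat) : (b <= d -> a + b = c' + c' -> 2 * c' - d <= a)%N by clear; lia.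
(* The intersection makes the inclusion required by [janson] hold for non-injective maps too. *)
pose S f := copy f :&: edges_of n.
have SE f : f \in F -> S f = copy f by move=> /Finj/copy_sub/setIidPl.
pose K : R := (2 ^ k * k ^ k)%:R; rewrite -/K.
pose m : R := n%:R ^+ k * p ^+ #|H|.
have Phim : Phi <= m.
  have iT : induced setT = H by apply/setP => e; rewrite inE subsetT andbT.
  by have := hPhi setT; rewrite iT cardsT card_ord; apply.
have m0 : 0 < m by apply: lt_le_trans Phim.
have k0 : (0 < k)%N.
  case/set0Pn: H0 => e /(subsetP HE); rewrite inE => /eqP e2.
  by have := max_card (mem e); rewrite e2 card_ord => /ltnW.
have K1 : 1 <= K by rewrite /K ler1n muln_gt0 !expn_gt0 k0.
have bound f g : f \in F -> g \in F -> (f != g) && (S f :&: S g != set0) ->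
  p ^+ #|S f :|: S g| <= \sum_(J : {set 'I_k} | induced J != set0) \sum_(s : {ffun 'I_k -> 'I_k})
     ([forall i in J, f i == g (s i)])%:R * p ^+ (2 * #|H| - #|induced J|).
  move=> fF gF /andP[_]; rewrite !SE // => fg.
  have sub := copyI_sub g (Finj f fF).
  set J := [set i | f i \in codom g] in sub.
  have J0 : induced J != set0.
    by apply: contraNneq fg => J0; rewrite -subset0 (subset_trans sub) // J0 imset0.
  (* Outside the overlap [s i] defaults to [i], a value on which nothing depends. *)
  pose s : {ffun 'I_k -> 'I_k} := [ffun i => odflt i [pick j | f i == g j]].
  rewrite (bigD1 J) //= (bigD1 s) //=.
  have -> : [forall i in J, f i == g (s i)].
    apply/forall_inP => i; rewrite inE ffunE => /codomP[j fj].
    by case: pickP => //= /(_ j); rewrite fj eqxx.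
  rewrite mul1r -addrA; apply: (@le_trans _ _ (p ^+ (2 * #|H| - #|induced J|))); last first.
    rewrite lerDl addr_ge0 //.
      by apply: sumr_ge0 => s' _; rewrite mulr_ge0 ?ler0n ?exprn_ge0.
    apply: sumr_ge0 => J' _; apply: sumr_ge0 => s' _; by rewrite mulr_ge0 ?ler0n ?exprn_ge0.
  apply: ler_wiXn2l => //.
  have := cardsUI (copy f) (copy g); rewrite !card_copy; try exact: Finj.
  have := subset_leq_card sub; rewrite card_imset; last by apply/imset_inj/Finj.
  exact: arith.
(* For fixed [(J, s)] the pair is determined by [g] and the values of [f] off [J]: at most
   [n^(2k - #|J|)] pairs, each of weight [p^(2 #|H| - #|induced J|)], in total at most
   [m^2 / Phi]. *)
have Delta : \sum_(f in F) \sum_(g in F | (f != g) && (S f :&: S g != set0)) p ^+ #|S f :|: S g|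
    <= K * (m ^+ 2 / Phi).
  apply: (@le_trans _ _ (\sum_(f in F) \sum_(g in F) \sum_(J : {set 'I_k} | induced J != set0)
     \sum_(s : {ffun 'I_k -> 'I_k}) ([forall i in J, f i == g (s i)])%:R * p ^+ (2 * #|H| - #|induced J|))).
    apply: ler_sum => f fF; rewrite big_mkcondr /=; apply: ler_sum => g gF.
    case: ifP => [fg|_]; first exact: bound.
    by apply: sumr_ge0 => J' _; apply: sumr_ge0 => s' _; rewrite mulr_ge0 ?ler0n ?exprn_ge0.
  rewrite exchange_big /=.
  under eq_bigr => g _ do rewrite exchange_big /=.
  rewrite exchange_big /=.
  apply: (@le_trans _ _ (\sum_(J : {set 'I_k} | induced J != set0)
      \sum_(s : {ffun 'I_k -> 'I_k}) m ^+ 2 / Phi)); last first.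
    rewrite big_mkcond /=.
    apply: (@le_trans _ _ (\sum_(J : {set 'I_k}) \sum_(s : {ffun 'I_k -> 'I_k}) m ^+ 2 / Phi)).
      apply: ler_sum => J _; case: ifP => // _; apply: sumr_ge0 => s _.
      by rewrite divr_ge0 ?exprn_ge0 ?ltW.
    rewrite !sumr_const -mulrnA card_ffun -[X in (_ * X)%N]cardsT -powersetT card_powerset cardsT.
    by rewrite card_ord -[leLHS]mulr_natl mulnC.
  apply: ler_sum => J J0.
  under eq_bigr => g _ do rewrite exchange_big /=.
  rewrite exchange_big /=; apply: ler_sum => s _.
  under eq_bigr => g _ do rewrite -big_distrl /=.
  rewrite -big_distrl /=.
  have cnt : \sum_(g in F) \sum_(f in F) ([forall i in J, f i == g (s i)])%:R <=
     n%:R ^+ k * n%:R ^+ (k - #|J|) :> R.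
    apply: (@le_trans _ _ (\sum_(g : {ffun 'I_k -> 'I_n}) n%:R ^+ (k - #|J|))); last first.
      by rewrite sumr_const card_ffun !card_ord -[leLHS]mulr_natl natrX.
    rewrite big_mkcond /=; apply: ler_sum => g _; case: ifP => [_|_]; last by rewrite exprn_ge0.
    rewrite -natrX -(card_prescribed J (fun i => g (s i))) -sum1_card natr_sum.
    rewrite big_mkcond [leRHS]big_mkcond /=; apply: ler_sum => f _; rewrite inE.
    by case: ifP; case: ifP.
  have hJ := hPhi J J0.
  have Jk : (#|J| <= k)%N by have := max_card (mem J); rewrite card_ord.
  have iH : (#|induced J| <= #|H|)%N.
    by apply/subset_leq_card/subsetP => e; rewrite inE => /andP[].
  apply: (@le_trans _ _ (n%:R ^+ k * n%:R ^+ (k - #|J|) * p ^+ (2 * #|H| - #|induced J|))).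
    by apply: ler_wpM2r => //; rewrite exprn_ge0.
  rewrite ler_pdivlMr //.
  set a := (n%:R ^+ k * _ * _); apply: (@le_trans _ _ (a * (n%:R ^+ #|J| * p ^+ #|induced J|))).
    by apply: ler_wpM2l => //; rewrite !mulr_ge0 ?exprn_ge0.
  have -> : a * (n%:R ^+ #|J| * p ^+ #|induced J|) = n%:R ^+ k * (n%:R ^+ (k - #|J|) * n%:R ^+ #|J|)
     * (p ^+ (2 * #|H| - #|induced J|) * p ^+ #|induced J|).
    by rewrite /a mulrACA; congr (_ * _); rewrite mulrA.
  rewrite -!exprD !subnK //; last by rewrite mul2n -addnn (leq_trans iH) ?leq_addr.
  by rewrite /m exprMn -!exprM addnn -mul2n [(k * 2)%N]mulnC [(#|H| * 2)%N]mulnC.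
(* This [q] minimises [- q c m + q^2 K m^2 / Phi]; it is at most 1 because [Phi <= m] and
   [c <= 1 <= K]. *)
clearbody K; pose q := c * Phi / (2 * K * m).
have K0 : 0 < K by apply: lt_le_trans K1.
have D0 : 0 < 2 * K * m by rewrite mulr_gt0 // mulr_gt0.
have q01 : 0 <= q <= 1.
  apply/andP; split; first by apply: divr_ge0; [apply: mulr_ge0|]; apply: ltW.
  rewrite ler_pdivrMr // mul1r; apply: (@le_trans _ _ (1 * m)).
    by apply: ler_pM => //; apply: ltW.
  by apply: ler_wpM2r; [exact: ltW|lra].
have Fm : c * m <= \sum_(f in F) p ^+ #|S f|.
  rewrite (eq_bigr (fun=> p ^+ #|H|)); last by move=> f fF; rewrite SE // card_copy //; apply: Finj.
  rewrite sumr_const -mulr_natl /m mulrA; apply: ler_wpM2r => //; exact: exprn_ge0.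
have SU f : S f \subset edges_of n by apply: subsetIr.
apply: (@le_trans _ _ (Pr p (edges_of n) (fun E => forall f, f \in F -> ~~ (S f \subset E)))).
  by apply: Pr_le => // E _ h f fF; rewrite SE //; apply: h.
apply: (le_trans (janson p0' p1 SU F q01)); rewrite ler_expR.
have [q0 _] := andP q01.
have h1 := ler_wpM2l q0 Fm.
have h2 := ler_wpM2l (exprn_ge0 2 q0) Delta.
have -> : - (c ^+ 2 * Phi / (4 * K)) = - (q * (c * m)) + q ^+ 2 * (K * (m ^+ 2 / Phi)).
  rewrite /q; field; rewrite !gt_eqF //.
by lra.
Qed.
End Copies.

(** * Ordered pairs of adjacent vertices *)

Section Pairs.
Variable V : finType.
Implicit Types (e : rel V) (A B : {set V}) (S : {set {set V}}).

Definition adj S : rel V := fun x y => [set x; y] \in S.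
(** Pairs are ordered, so an edge with both ends in [A :&: B] counts twice; hence the factor 2 in
    [handshake]. *)
Definition npairs e A B : nat := #|[set xy in setX A B | e xy.1 xy.2]|.
Definition nbr e x B : {set V} := [set y in B | e x y].

Lemma npairs_sum e A B : npairs e A B = (\sum_(x in A) #|nbr e x B|)%N.
Proof.
rewrite /npairs -sum1_card.
rewrite (eq_bigl (fun xy : V * V => (xy.1 \in A) && (xy.2 \in nbr e xy.1 B))); last first.
  by move=> [x y]; rewrite !inE /= andbA.
rewrite -(pair_big_dep (mem A) (fun x y => y \in nbr e x B) (fun _ _ => 1%N)) /=.
by apply: eq_bigr => x _; rewrite sum1_card.
Qed.

Lemma npairs_mono e e' A B A' B' :
  (forall x y, e x y -> e' x y) -> A \subset A' -> B \subset B' ->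
  (npairs e A B <= npairs e' A' B')%N.
Proof.
move=> ee AA BB; apply/subset_leq_card/subsetP => -[x y]; rewrite !inE /=.
by move=> /andP[/andP[/(subsetP AA) -> /(subsetP BB) ->] /ee].
Qed.

Lemma adj_sym S : symmetric (adj S).
Proof. by move=> x y; rewrite /adj setUC. Qed.

Lemma card_ends (d : {set V}) : #|d| == 2%N ->
  #|[set xy : V * V | [set xy.1; xy.2] == d]| = 2%N.
Proof.
case/cards2P => a [b [ab ->]].
have -> : [set xy : V * V | [set xy.1; xy.2] == [set a; b]] = [set (a, b); (b, a)].
  apply/setP => -[x y]; rewrite !inE /= !xpair_eqE; apply/eqP/idP => [h|].
    have hx : x \in [set a; b] by rewrite -h !inE eqxx.
    have hy : y \in [set a; b] by rewrite -h !inE eqxx orbT.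
    have ha : a \in [set x; y] by rewrite h !inE eqxx.
    have hb : b \in [set x; y] by rewrite h !inE eqxx orbT.
    move: hx hy ha hb ab; rewrite !inE; clear.
    do 2![case/orP => /eqP->]; rewrite ?eqxx ?orbT ?orbb //=.
      by move=> _ /eqP->; rewrite eqxx.
    by move=> /eqP->; rewrite eqxx.
  by case/orP => /andP[/eqP-> /eqP->] //; rewrite setUC.
by rewrite cards2 xpair_eqE (negbTE ab).
Qed.

Lemma handshake S : (forall d, d \in S -> #|d| == 2%N) ->
  npairs (adj S) setT setT = (2 * #|S|)%N.
Proof.
move=> S2; rewrite /npairs -sum1_card.
rewrite (partition_big (fun xy : V * V => [set xy.1; xy.2]) (mem S)) /=; last first.
  by move=> [x y]; rewrite !inE.
rewrite (eq_bigr (fun=> 2%N)) => [|d dS]; first by rewrite sum_nat_const mulnC.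
rewrite -(card_ends (S2 d dS)) -sum1_card; apply: eq_bigl => -[x y]; rewrite !inE /= /adj.
by case: eqP => [->|]; rewrite ?andbF // dS.
Qed.

End Pairs.

Lemma leq_card_bigcup (I T : finType) (P : pred I) (F : I -> {set T}) :
  (#|\bigcup_(i | P i) F i| <= \sum_(i | P i) #|F i|)%N.
Proof.
elim/big_rec2: _ => [|i m A _ le_m]; first by rewrite cards0.
by apply: leq_trans (leq_card_setU _ _) _; rewrite leq_add2l.
Qed.

(** * Copies of a graph with prescribed vertex classes *)

Section Transversals.
Variables (R : realType) (k : nat) (H : {set {set 'I_k}}).
Hypotheses (HE : is_graph H) (H0 : H != set0).

(** Injectivity of [f] is not demanded: for a [spread] family it follows from the disjointness of
    the classes. *)
Definition transv n (T : 'I_k -> {set 'I_n}) (S : {set {set 'I_n}}) : Prop :=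
  exists f : {ffun 'I_k -> 'I_n}, (forall i, f i \in T i) /\ copy H f \subset S.

Definition spread n (kappa : R) (T : 'I_k -> {set 'I_n}) : Prop :=
  (forall i, kappa * n%:R <= #|T i|%:R) /\ (forall i j, i != j -> [disjoint T i & T j]).

(** Up to constants, every subgraph of [H] with an edge has at least [Phi] expected copies in
    [G(n,p)]. *)
Definition balanced n (p Phi : R) : Prop :=
  forall J, induced H J != set0 -> Phi <= n%:R ^+ #|J| * p ^+ #|induced H J|.

(** The rate in [copies_janson] for [c = kappa ^+ k / 2], the proportion of maps provided by
    [card_avoiding]. *)
Definition jrate (kappa : R) : R := kappa ^+ (2 * k) / (16 * (2 ^ k * k ^ k)%:R).

Let k2 : (1 < k)%N.
Proof.
case/set0Pn: H0 => e /(subsetP HE); rewrite inE => /eqP e2.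
by have := max_card (mem e); rewrite e2 card_ord.
Qed.

Lemma jrate_gt0 kappa : 0 < kappa -> 0 < jrate kappa.
Proof.
move=> k0; rewrite divr_gt0 ?exprn_gt0 // mulr_gt0 // ltr0n muln_gt0 !expn_gt0 /=.
by rewrite (ltnW k2).
Qed.

Lemma card_edges_le n : (#|edges_of n| <= n ^ 2)%N.
Proof.
have -> : #|edges_of n| = 'C(n, 2).
  by rewrite card_draws card_ord.
by rewrite bin2 -divn2; apply: leq_trans (leq_div _ _) _; rewrite expnS expn1 leq_mul2l leq_pred orbT.
Qed.

(** At least [(kappa n)^k] maps respect the classes. An edge of [H] is sent into a given member of
    [D] by at most [4 n^(k-2)] maps, and [H] has at most [k^2] edges, so the bound on [D] spoils at
    most half of [(kappa n)^k]. *)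
Lemma card_avoiding n kappa (T : 'I_k -> {set 'I_n}) (D : {set {set 'I_n}}) :
  0 < kappa -> spread kappa T -> D \subset edges_of n ->
  #|D|%:R <= kappa ^+ k / (8 * k%:R ^+ 2) * n%:R ^+ 2 ->
  kappa ^+ k / 2 * n%:R ^+ k <=
    #|[set f : {ffun 'I_k -> 'I_n} | [forall i, f i \in T i] & [disjoint copy H f & D]]|%:R :> R.
Proof.
move=> k0 [Tk _] DE Dle.
pose A := [set f : {ffun 'I_k -> 'I_n} | [forall i, f i \in T i]].
pose hit (e : {set 'I_k}) (d : {set 'I_n}) :=
  [set f : {ffun 'I_k -> 'I_n} | [forall i in e, f i \in d]].
set F := [set f | _].
have sub : A \subset F :|: \bigcup_(e in H) \bigcup_(d in D) hit e d.
  apply/subsetP => f; rewrite !inE => fT; rewrite fT /=.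
  case: (boolP [disjoint copy H f & D]) => //=; rewrite -setI_eq0 => /set0Pn[d].
  rewrite inE => /andP[/imsetP[e eH ->] dD].
  apply/bigcupP; exists e => //; apply/bigcupP; exists (f @: e) => //.
  by rewrite inE; apply/forall_inP => i ie; apply: imset_f.
have hitc e d : e \in H -> d \in D -> (#|hit e d| <= 4 * n ^ (k - 2))%N.
  move=> eH dD.
  have e2 : #|e| = 2%N by have := subsetP HE e eH; rewrite inE => /eqP.
  have d2 : #|d| = 2%N by have := subsetP DE d dD; rewrite inE => /eqP.
  have -> : #|hit e d| = #|family (fun i => if i \in e then [pred x | x \in d] else predT)|.
    apply: eq_card => f; rewrite inE; apply/forall_inP/familyP => hf i.
      by case: ifP => // /hf.
    by move=> ie; have := hf i; rewrite ie.
  rewrite card_familyE (bigID (mem e)) /= leq_mul //.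
    rewrite (eq_bigr (fun=> 2%N)) => [|i ->]; first by rewrite prod_nat_const e2.
    by rewrite -[RHS]d2; apply: eq_card => x; rewrite inE.
  rewrite (eq_bigr (fun=> n)) => [|i /negbTE->]; last by rewrite cardT size_enum_ord.
  rewrite prod_nat_const -e2 leq_eqVlt; apply/orP; left; apply/eqP; congr (_ ^ _)%N.
  have := cardC (mem e); rewrite card_ord => h.
  have -> : #|(fun i => i \notin e)| = #|[predC mem e]| by apply: eq_card.
  apply/eqP; rewrite -(eqn_add2l #|e|) [X in X == _]h subnKC //.
  by have := max_card (mem e); rewrite card_ord.
have Hk : (#|H| <= k ^ 2)%N := leq_trans (subset_leq_card HE) (card_edges_le k).
have hits : (#|\bigcup_(e in H) \bigcup_(d in D) hit e d| <= k ^ 2 * (#|D| * (4 * n ^ (k - 2))))%N.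
  apply: (leq_trans (leq_card_bigcup _ _)).
  apply: (@leq_trans (\sum_(e in H) #|D| * (4 * n ^ (k - 2)))); last first.
    by rewrite sum_nat_const leq_mul2r Hk orbT.
  apply: leq_sum => e eH; apply: (leq_trans (leq_card_bigcup _ _)).
  by rewrite -sum_nat_const; apply: leq_sum => d dD; apply: hitc.
have cA : (kappa * n%:R) ^+ k <= #|A|%:R.
  have -> : #|A| = #|family T|.
    by apply: eq_card => f; rewrite inE; apply/forallP/familyP.
  rewrite card_familyE natr_prod -[k in _ ^+ k]card_ord -prodr_const.
  by apply: ler_prod => i _; rewrite mulr_ge0 ?ler0n ?Tk ?(ltW k0).
have := subset_leq_card sub => cF.
have {cF} cF : #|A|%:R <= #|F|%:R + (k ^ 2 * (#|D| * (4 * n ^ (k - 2))))%:R :> R.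
  rewrite -natrD ler_nat; apply: (leq_trans cF); apply: leq_trans (leq_card_setU _ _) _.
  by rewrite leq_add2l.
have hD : (k ^ 2 * (#|D| * (4 * n ^ (k - 2))))%:R <= kappa ^+ k / 2 * n%:R ^+ k :> R.
  rewrite !natrM !natrX.
  have kk : (k%:R : R) != 0 by rewrite pnatr_eq0 -lt0n (ltnW k2).
  have -> : kappa ^+ k / 2 * n%:R ^+ k =
     k%:R ^+ 2 * (kappa ^+ k / (8 * k%:R ^+ 2) * n%:R ^+ 2 * (4 * n%:R ^+ (k - 2))).
    have nk : n%:R ^+ k = n%:R ^+ 2 * n%:R ^+ (k - 2) :> R by rewrite -exprD subnKC.
    rewrite nk; move: (kappa ^+ k) (n%:R ^+ (k - 2)) => a b; field.
    by rewrite kk.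
  rewrite -expr2; apply: ler_wpM2l; first by rewrite exprn_ge0.
  by apply: ler_wpM2r => //; rewrite mulr_ge0 ?exprn_ge0.
rewrite exprMn in cA; lra.
Qed.

(** Containing [D] is increasing and missing all copies that avoid [D] is decreasing, so Harris
    multiplies the two bounds. The factor [p ^+ #|D|] is what makes a union bound over [D]
    affordable. *)
Lemma transv_janson n (p kappa Phi : R) (T : 'I_k -> {set 'I_n}) (D : {set {set 'I_n}}) :
  0 < p -> p <= 1 -> 0 < kappa -> kappa <= 1 -> 0 < Phi -> balanced n p Phi ->
  spread kappa T -> D \subset edges_of n ->
  #|D|%:R <= kappa ^+ k / (8 * k%:R ^+ 2) * n%:R ^+ 2 ->
  Pr p (edges_of n) (fun E => D \subset E /\ ~ transv T (E :\: D)) <=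
  p ^+ #|D| * expR (- (jrate kappa * Phi)).
Proof.
move=> p0 p1 k0 k1 Phi0 bal sT DE Dle.
have cF := card_avoiding k0 sT DE Dle.
set F := [set f | _] in cF.
have Finj : {in F, forall f : {ffun 'I_k -> 'I_n}, injective f}.
  move=> f; rewrite inE => /andP[/forallP fT _] i j fij; apply/eqP; apply: contraTT isT => ij.
  have := sT.2 i j ij; rewrite disjoint_subset => /subsetP/(_ (f i) (fT i)).
  by rewrite inE fij fT.
have c0 : 0 < kappa ^+ k / 2 by rewrite divr_gt0 ?exprn_gt0.
have c1 : kappa ^+ k / 2 <= 1.
  have : kappa ^+ k <= 1 by rewrite exprn_ile1 // ltW.
  lra.
have := copies_janson HE p0 p1 c0 c1 Phi0 H0 bal Finj cF.
have -> : (kappa ^+ k / 2) ^+ 2 * Phi / (4 * (2 ^ k * k ^ k)%:R) = jrate kappa * Phi.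
  rewrite /jrate [(2 * k)%N]mulnC exprM.
  have K0 : ((2 ^ k * k ^ k)%:R : R) != 0 by rewrite pnatr_eq0 -lt0n muln_gt0 !expn_gt0 /= (ltnW k2).
  move: (kappa ^+ k) ((2 ^ k * k ^ k)%:R) K0 => a b b0; field.
  by rewrite b0.
move=> hF; apply: le_trans (ler_wpM2l (exprn_ge0 #|D| (ltW p0)) hF).
rewrite -(@Ex_sup _ _ p (edges_of n) D DE).
set Q := fun E : {set {set 'I_n}} => forall f, f \in F -> ~~ (copy H f \subset E).
apply: (@le_trans _ _ (Ex p (edges_of n) (fun E => (D \subset E)%:R * `[< Q E >]%:R))).
  apply: le_Ex; rewrite ?(ltW p0) // => E _.
  case: asboolP => [[DsE hE]|_]; last by rewrite mulr_ge0 ?ler0n.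
  rewrite DsE mul1r asboolT // => f; rewrite inE => /andP[/forallP fT fD].
  by apply/negP => fE; apply: hE; exists f; split=> //; rewrite subsetD fE.
apply: Ex_harris; rewrite ?(ltW p0) // => A B AB.
  rewrite ler_nat; case: (boolP (D \subset A)) => // DA.
  by rewrite (subset_trans DA AB).
rewrite ler_nat; case: asboolP => // hB; rewrite asboolT // => f fF.
by apply: contra (hB f fF) => fA; apply: subset_trans AB.
Qed.

End Transversals.

(** * Properties of G(n,p) holding for all large vertex sets *)

Section UnionBounds.
Variable R : realType.

(** Turns an exponent of at least [1 / eps] into a failure probability of at most [eps]. *)
Lemma expRN_inv_le (eps : R) : 0 < eps -> expR (- eps^-1) <= eps.
Proof.
move=> e0; rewrite expRN -[leRHS]invrK lef_pV2 ?posrE ?expR_gt0 ?invr_gt0 //.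
by apply: le_trans (expR_ge1Dx _); rewrite lerDr.
Qed.

Lemma natr_exp2_le n : (2 ^ n)%:R <= expR n%:R :> R.
Proof.
rewrite natrX -[n%:R]mulr1 expRM_natl; apply: lerXn2r; rewrite ?nnegrE ?expR_ge0 //.
by apply: le_trans (expR_ge1Dx _).
Qed.

(** The binomial theorem, read off [Ex_expr_card] at [p = 1/2], where all subsets have equal
    weight. *)
Lemma sum_expr_subsets (T : finType) (U : {set T}) (y : R) :
  \sum_(D : {set T} | D \subset U) y ^+ #|D| = (1 + y) ^+ #|U|.
Proof.
have h2 : (2^-1 : R) != 0 by rewrite invr_neq0.
have := Ex_expr_card (2^-1 : R) y (subxx U).
have -> : 1 - 2^-1 + 2^-1 * y = 2^-1 * (1 + y) by field.
rewrite exprMn => h; apply: (mulfI (expf_neq0 #|U| h2)); rewrite -h /Ex big_distrr /=.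
apply: eq_bigr => D DU; rewrite (setIidPl DU).
have -> : 1 - 2^-1 = 2^-1 :> R by field.
by rewrite -exprD subnKC // subset_leq_card.
Qed.

(** Exponential weighting: [exp (s (x - #|D|)) >= 1] for the sets counted, and the weighted sum over
    all subsets is a binomial expansion. *)
Lemma sum_small_subsets (T : finType) (U : {set T}) (p s x : R) : 0 <= p -> 0 <= s ->
  \sum_(D : {set T} | (D \subset U) && (#|D|%:R <= x)) p ^+ #|D| <=
  expR (s * x + p * expR (- s) * #|U|%:R).
Proof.
move=> p0 s0.
apply: (@le_trans _ _ (\sum_(D : {set T} | D \subset U) expR (s * x) * (p * expR (- s)) ^+ #|D|)).
  rewrite big_mkcondr; apply: ler_sum => D _; case: ifP => [Dx|_]; last first.
    by rewrite mulr_ge0 ?exprn_ge0 ?expR_ge0 // mulr_ge0 ?expR_ge0.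
  rewrite exprMn -expRM_natl mulrCA -expRD ler_peMr ?exprn_ge0 //.
  by rewrite -[leLHS]expR0 ler_expR mulrN subr_ge0 [leLHS]mulrC ler_wpM2l.
rewrite -big_distrr /= sum_expr_subsets expRD ler_wpM2l ?expR_ge0 //.
rewrite [_ * #|U|%:R]mulrC expRM_natl; apply: lerXn2r; rewrite ?nnegrE ?expR_ge0 //.
  by rewrite addr_ge0 // mulr_ge0 ?expR_ge0.
exact: expR_ge1Dx.
Qed.

Section Robust.
Variables (k : nat) (H : {set {set 'I_k}}).
Hypotheses (HE : is_graph H) (H0 : H != set0).

(** The classes are fixed before the edges are drawn, so no union bound is taken and [Phi] need only
    exceed a constant. This is the form applied to [K_graph t]. *)
Lemma transv_fixed (kappa eps : R) : 0 < kappa -> kappa <= 1 -> 0 < eps ->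
  exists2 M : R, 0 < M & forall n (p Phi : R) (T : 'I_k -> {set 'I_n}),
    0 < p -> p <= 1 -> M <= Phi -> balanced H n p Phi -> spread kappa T ->
    Pr p (edges_of n) (fun E => ~ transv H T E) <= eps.
Proof.
move=> k0 k1 e0; have c0 := jrate_gt0 HE H0 k0.
exists (eps^-1 / jrate k kappa) => [|n p Phi T p0 p1 MPhi bal sT].
  by rewrite divr_gt0 ?invr_gt0.
have Phi0 : 0 < Phi by apply: lt_le_trans MPhi; rewrite divr_gt0 ?invr_gt0.
have := transv_janson HE H0 p0 p1 k0 k1 Phi0 bal sT (sub0set _).
rewrite cards0 expr0 mul1r => /(_ _) h.
apply: (@le_trans _ _ (expR (- (jrate k kappa * Phi)))).
  apply: le_trans (h _); last by rewrite mulr_ge0 ?exprn_ge0 // divr_ge0 ?mulr_ge0 ?exprn_ge0 ?ler0n // ltW.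
  by apply: Pr_le => //; rewrite ?(ltW p0) // => E _ hE; rewrite sub0set setD0.
apply: le_trans (expRN_inv_le e0); rewrite ler_expR lerN2 mulrC.
by rewrite -ler_pdivrMr.
Qed.

(** A union bound over the [2^(n k)] families of classes; [Phi] must exceed a large multiple of [n],
    as it does for [K_graph t.-1]. *)
Lemma transv_all (kappa eps : R) : 0 < kappa -> kappa <= 1 -> 0 < eps ->
  exists2 M : R, 0 < M & forall n (p Phi : R), (0 < n)%N ->
    0 < p -> p <= 1 -> M * n%:R <= Phi -> balanced H n p Phi ->
    Pr p (edges_of n) (fun E => ~ forall T : 'I_k -> {set 'I_n}, spread kappa T -> transv H T E) <= eps.
Proof.
move=> k0 k1 e0; have c0 := jrate_gt0 HE H0 k0.
have M0 : 0 < (k%:R + eps^-1) / jrate k kappa.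
  by rewrite divr_gt0 // ltr_wpDl ?invr_gt0.
exists ((k%:R + eps^-1) / jrate k kappa) => // n p Phi n0 p0 p1 MPhi bal.
have n0' : 0 < n%:R :> R by rewrite ltr0n.
have Phi0 : 0 < Phi by apply: lt_le_trans MPhi; rewrite mulr_gt0.
pose A (T : {ffun 'I_k -> {set 'I_n}}) E := ~ transv H T E.
apply: (@le_trans _ _ (Pr p (edges_of n) (fun E =>
    exists2 T : {ffun 'I_k -> {set 'I_n}}, `[< spread kappa T >] & A T E))).
  apply: Pr_le => //; rewrite ?(ltW p0) // => E _ hE; apply: contrapT => no; apply: hE => T sT.
  apply: contrapT => hT; apply: no; exists (finfun T).
    by apply/asboolP; have -> : (finfun T : _ -> _) = T by apply: funext => i; rewrite ffunE.
  by rewrite /A; have -> : (finfun T : _ -> _) = T by apply: funext => i; rewrite ffunE.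
apply: le_trans (Pr_exists _ _ _ _ _) _; rewrite ?(ltW p0) //.
apply: (@le_trans _ _ (\sum_(T : {ffun 'I_k -> {set 'I_n}}) expR (- (jrate k kappa * Phi)))).
  rewrite big_mkcond; apply: ler_sum => T _; case: ifP => [/asboolP sT|_]; last exact: expR_ge0.
  have := transv_janson HE H0 p0 p1 k0 k1 Phi0 bal sT (sub0set _).
  rewrite cards0 expr0 mul1r => h; apply: le_trans (h _).
    by apply: Pr_le => //; rewrite ?(ltW p0) // => E _ hE; rewrite sub0set setD0.
  by rewrite mulr_ge0 ?exprn_ge0 // divr_ge0 ?mulr_ge0 ?exprn_ge0 ?ler0n // ltW.
rewrite sumr_const card_ffun card_ord -cardsT -powersetT card_powerset cardsT card_ord -expnM.
rewrite -[leLHS]mulr_natl.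
apply: le_trans (ler_wpM2r (expR_ge0 _) (natr_exp2_le _)) _; rewrite -expRD.
apply: le_trans (expRN_inv_le e0); rewrite ler_expR.
have h1 : (k%:R + eps^-1) * n%:R <= jrate k kappa * Phi.
  by rewrite [leRHS]mulrC -ler_pdivrMr // mulrAC.
have h2 : eps^-1 <= eps^-1 * n%:R by rewrite ler_peMr ?invr_ge0 ?(ltW e0) // ler1n.
rewrite natrM; lra.
Qed.

(* The failure probability [expR (- c n^2 p)] of a fixed [D] beats the expected number of
   candidates [D] inside [E], since [c] does not depend on [delta]. *)
Lemma transv_robust (kappa : R) : 0 < kappa -> kappa <= 1 ->
  exists2 delta : R, 0 < delta <= 1 & forall eps : R, 0 < eps ->
  exists2 M : R, 0 < M & forall n (p : R),
    0 < p -> p <= 1 -> M <= n%:R * p -> balanced H n p (n%:R ^+ 2 * p) ->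
    Pr p (edges_of n) (fun E => ~ forall (T : 'I_k -> {set 'I_n}) (D : {set {set 'I_n}}),
       spread kappa T -> D \subset E -> #|D|%:R <= delta * (n%:R ^+ 2 * p) ->
       transv H T (E :\: D)) <= eps.
Proof.
move=> k0 k1.
have [c c0 cE] : exists2 c, 0 < c & jrate k kappa = c by exists (jrate k kappa) => //; apply: (jrate_gt0 HE H0).
have kk : 0 < (k%:R : R).
  rewrite ltr0n; case/set0Pn: H0 => e /(subsetP HE); rewrite inE => /eqP e2.
  by have := max_card (mem e); rewrite e2 card_ord => /ltnW.
pose d0 := kappa ^+ k / (8 * k%:R ^+ 2).
have d00 : 0 < d0 by rewrite divr_gt0 ?mulr_gt0 ?exprn_gt0.
(* The first bound is the one of [card_avoiding]; the second gives [s * delta <= c / 4] for the [s]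
   below. *)
pose delta := Num.min d0 (c ^+ 2 / 16).
have del0 : 0 < delta by rewrite lt_min d00 /= divr_gt0 ?exprn_gt0.
have d01 : d0 <= 1.
  rewrite ler_pdivrMr ?mulr_gt0 ?exprn_gt0 // mul1r.
  apply: (@le_trans _ _ 1); first by rewrite exprn_ile1 // ltW.
  have kn : (0 < k)%N by rewrite -(ltr0n R).
  by rewrite -natrX -natrM ler1n muln_gt0 expn_gt0 kn.
exists delta => [|eps e0]; first by rewrite del0 ge_min d01.
have M0 : 0 < 2 / c * (k%:R + eps^-1).
  by apply: mulr_gt0; [exact: divr_gt0|apply: addr_gt0; rewrite // invr_gt0].
exists (2 / c * (k%:R + eps^-1)) => // n p p0 p1 Mnp bal.
have np0 : 0 < n%:R * p by apply: lt_le_trans Mnp.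
have n0' : 0 < n%:R :> R by rewrite -(pmulr_lgt0 _ p0).
have n1 : 1 <= n%:R :> R by rewrite ler1n -(ltr0n R).
pose Phi := n%:R ^+ 2 * p; have Phi0 : 0 < Phi by rewrite mulr_gt0 ?exprn_gt0.
pose G (TD : {ffun 'I_k -> {set 'I_n}} * {set {set 'I_n}}) :=
  `[< spread kappa TD.1 >] && ((TD.2 \subset edges_of n) && (#|TD.2|%:R <= delta * Phi)).
pose A (TD : {ffun 'I_k -> {set 'I_n}} * {set {set 'I_n}}) (E : {set {set 'I_n}}) :=
  TD.2 \subset E /\ ~ transv H TD.1 (E :\: TD.2).
apply: (@le_trans _ _ (Pr p (edges_of n) (fun E => exists2 TD, G TD & A TD E))).
  apply: Pr_le => //; rewrite ?(ltW p0) // => E EU hE; apply: contrapT => no; apply: hE => T D sT DE Dx.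
  apply: contrapT => hT; apply: no; exists (finfun T, D); rewrite /G /A /=;
    have -> : (finfun T : _ -> _) = T by apply: funext => i; rewrite ffunE.
    by rewrite (subset_trans DE EU) Dx !andbT; apply/asboolP.
  by [].
apply: le_trans (Pr_exists _ _ _ _ _) _; rewrite ?(ltW p0) //.
apply: (@le_trans _ _ (\sum_(TD | G TD) p ^+ #|TD.2| * expR (- (c * Phi)))).
  apply: ler_sum => -[T D] /andP[/asboolP sT /andP[DU Dx]] /=.
  rewrite -cE; apply: transv_janson => //; apply: le_trans Dx _.
  apply: (@le_trans _ _ (d0 * Phi)); first by apply: ler_wpM2r; [exact: ltW|rewrite ge_min lexx].
  by rewrite ler_wpM2l ?(ltW d00) // ler_piMr ?exprn_ge0.
rewrite -big_distrl /=.
have hs : \sum_(TD | G TD) p ^+ #|TD.2| <= (2 ^ (n * k))%:R *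
    \sum_(D : {set {set 'I_n}} | (D \subset edges_of n) && (#|D|%:R <= delta * Phi)) p ^+ #|D|.
  rewrite -(pair_big_dep (fun T : {ffun 'I_k -> {set 'I_n}} => `[< spread kappa T >])
     (fun _ (D : {set {set 'I_n}}) => (D \subset edges_of n) && (#|D|%:R <= delta * Phi))
     (fun _ (D : {set {set 'I_n}}) => p ^+ #|D|)) /=.
  have -> : (2 ^ (n * k))%N = #|{ffun 'I_k -> {set 'I_n}}|.
    by rewrite card_ffun card_ord -cardsT -powersetT card_powerset cardsT card_ord -expnM.
  rewrite mulr_natl -sumr_const big_mkcond; apply: ler_sum => T _; case: ifP => // _.
  by apply: sumr_ge0 => D _; rewrite exprn_ge0 // ltW.
(* Then [exp (- s) <= c / 4], and both terms of [sum_small_subsets] are at most [c / 4 * Phi]. Half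
   of the exponent [c * Phi] is left to pay for the choice of [T] and for [eps]. *)
pose s := 4 / c.
have s0 : 0 <= s by rewrite divr_ge0 // ltW.
have := sum_small_subsets (edges_of n) (delta * Phi) (ltW p0) s0 => hD.
have es : expR (- s) <= c / 4.
  rewrite expRN -[leRHS]invrK lef_pV2 ?posrE ?expR_gt0 ?invr_gt0 ?divr_gt0 //.
  by rewrite invf_div; apply: le_trans (expR_ge1Dx _); rewrite lerDr.
have En : #|edges_of n|%:R <= n%:R ^+ 2 :> R by rewrite -natrX ler_nat card_edges_le.
have hE2 : s * (delta * Phi) + p * expR (- s) * #|edges_of n|%:R <= c / 2 * Phi.
  have a1 : s * delta <= c / 4.
    have : delta <= c ^+ 2 / 16 by rewrite ge_min lexx orbT.
    move/(ler_wpM2l s0) => a; apply: (le_trans a).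
    by rewrite le_eqVlt; apply/orP; left; apply/eqP; rewrite /s; field; rewrite gt_eqF.
  have a2 : s * (delta * Phi) <= c / 4 * Phi by rewrite mulrA ler_wpM2r // ltW.
  have a3 : p * expR (- s) * #|edges_of n|%:R <= c / 4 * Phi.
    have -> : c / 4 * Phi = p * (c / 4) * n%:R ^+ 2 by rewrite /Phi; ring.
    by apply: ler_pM => //; rewrite ?mulr_ge0 ?expR_ge0 ?(ltW p0) // ler_wpM2l // ltW.
  lra.
apply: (@le_trans _ _ (expR (n * k)%:R * expR (c / 2 * Phi) * expR (- (c * Phi)))).
  apply: ler_wpM2r; first exact: expR_ge0.
  apply: (le_trans hs); apply: ler_pM; rewrite ?ler0n //.
  - by apply: sumr_ge0 => D _; rewrite exprn_ge0 // ltW.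
  - exact: natr_exp2_le.
  - by apply: (le_trans hD); rewrite ler_expR.
rewrite -!expRD; apply: le_trans (expRN_inv_le e0); rewrite ler_expR.
have h1 : (k%:R + eps^-1) * n%:R <= c / 2 * Phi.
  have -> : c / 2 * Phi = n%:R * p * (c / 2) * n%:R by rewrite /Phi; ring.
  apply: ler_wpM2r; first exact: ltW.
  apply: le_trans (ler_wpM2r _ Mnp); last by rewrite divr_ge0 // ltW.
  by rewrite le_eqVlt; apply/orP; left; apply/eqP; field; rewrite !gt_eqF.
have h2 : eps^-1 <= eps^-1 * n%:R by rewrite ler_peMr ?invr_ge0 ?(ltW e0).
rewrite natrM; lra.
Qed.

End Robust.
End UnionBounds.

(** * Expected subgraph counts above the threshold *)

Section Balance.
Variable R : realType.

Lemma ler_of_sqr (a b : R) : 0 <= b -> a ^+ 2 <= b ^+ 2 -> a <= b.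
Proof.
move=> b0 ab; have [a0|a0] := lerP 0 a; last exact: le_trans (ltW a0) b0.
by rewrite -(@ler_pXn2r _ 2).
Qed.

Lemma K_graph_is_graph k : is_graph (K_graph k).
Proof. exact: subxx. Qed.

Lemma K_graph_neq0 k : (1 < k)%N -> K_graph k != set0.
Proof.
move=> k2; rewrite -card_gt0 /K_graph card_draws card_ord bin_gt0 //.
Qed.

Lemma card_induced_K k (J : {set 'I_k}) : #|induced (K_graph k) J| = 'C(#|J|, 2).
Proof.
rewrite -cards_draws; apply: eq_card => e; rewrite !inE andbC //.
Qed.

Lemma mul2_bin2 j : (2 * 'C(j, 2) = j * j.-1)%N.
Proof. by rewrite mul2n bin2 halfK oddM; case: j => //= j; rewrite andNb subn0. Qed.

(** Stated with squares, which turn ['C(j, 2)] into [j * j.-1] and remove the root from [Phi]. *)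
Lemma balanced_K k n (p Phi : R) : 0 <= p ->
  (forall j, (2 <= j <= k)%N -> Phi ^+ 2 <= n%:R ^+ (2 * j) * p ^+ (j * j.-1)) ->
  balanced (K_graph k) n p Phi.
Proof.
move=> p0 h J J0; apply: ler_of_sqr; first by rewrite mulr_ge0 ?exprn_ge0.
rewrite card_induced_K exprMn -!exprM ![(_ * 2)%N]mulnC mul2_bin2; apply: h.
apply/andP; split; first by move: J0; rewrite -card_gt0 card_induced_K bin_gt0.
by have := max_card (mem J); rewrite card_ord.
Qed.

Section Threshold.
Variables (t n : nat) (p : R).
Hypotheses (t4 : (4 <= t)%N) (p0 : 0 < p) (p1 : p <= 1).
Let L : R := n%:R ^+ 2 * p ^+ t.-1.
Hypothesis L1 : 1 <= L.

Lemma le_scale j : (j <= t.-1)%N -> L <= n%:R ^+ 2 * p ^+ j.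
Proof.
move=> jt; apply: ler_wpM2l; first by rewrite exprn_ge0.
by apply: ler_wiXn2l; rewrite ?(ltW p0).
Qed.

(** The balance conditions for cliques reduce to this once a monomial in [n] and [p] is written with
    a power of [n^2 p^j], [j <= t - 1]. *)
Lemma scale_expr_ge j m : (j <= t.-1)%N -> (0 < m)%N -> L <= (n%:R ^+ 2 * p ^+ j) ^+ m.
Proof.
move=> jt m0; have h := le_scale jt; apply: (le_trans h).
by rewrite -[leLHS]expr1; apply: ler_weXn2l => //; apply: le_trans h.
Qed.

(** Here [n^(2j) p^(j(j-1)) = (n^2 p^(j-1))^j]. *)
Lemma balanced_K_t : balanced (K_graph t) n p (Num.sqrt L).
Proof.
have L0 : 0 <= L by apply: le_trans L1.
apply: balanced_K => [|j /andP[j2 jt]]; first exact: ltW.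
rewrite sqr_sqrtr // exprM mulnC exprM -exprMn; apply: scale_expr_ge.
  by rewrite -subn1 -[t.-1]subn1 leq_sub2r.
exact: leq_trans j2.
Qed.

(** Here [n^(2j) p^(j(j-1)) = n^2 (n^2 p^j)^(j-1)], with [j <= t - 1]. *)
Lemma balanced_K_pred : balanced (K_graph t.-1) n p (n%:R * Num.sqrt L).
Proof.
have L0 : 0 <= L by apply: le_trans L1.
apply: balanced_K => [|j /andP[j2 jt]]; first exact: ltW.
rewrite exprMn sqr_sqrtr //.
have -> : n%:R ^+ (2 * j) * p ^+ (j * j.-1) = n%:R ^+ 2 * (n%:R ^+ 2 * p ^+ j) ^+ j.-1.
  rewrite exprMn mulrA -!exprM -exprD; congr (n%:R ^+ _ * _); clear -j2; lia.
apply: ler_wpM2l; first by rewrite exprn_ge0.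
by apply: scale_expr_ge => //; case: j j2 {jt} => [|[]].
Qed.

(** Here [n^(2j) p^(j(j-1)) = (n^2 p)^2 (n^2 p^(j+1))^(j-2)], with [j + 1 <= t - 1]. *)
Lemma balanced_K_pred2 : balanced (K_graph t.-2) n p (n%:R ^+ 2 * p).
Proof.
apply: balanced_K => [|j /andP[j2 jt]]; first exact: ltW.
have -> : n%:R ^+ (2 * j) * p ^+ (j * j.-1) = (n%:R ^+ 2 * p) ^+ 2 * (n%:R ^+ 2 * p ^+ j.+1) ^+ (j - 2).
  rewrite !exprMn mulrACA -!exprM -!exprD; congr (n%:R ^+ _ * p ^+ _); clear -j2; nia.
rewrite ler_peMr ?exprn_ge0 // ?mulr_ge0 ?exprn_ge0 ?(ltW p0) //.
have [->|j3] := eqVneq j 2%N; first by rewrite subnn expr0.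
apply: le_trans L1 _; apply: scale_expr_ge; move: j2 jt j3; clear; lia.
Qed.

Lemma np_sqr_ge : L <= (n%:R * p) ^+ 2.
Proof. by rewrite exprMn; apply: le_scale; move: t4; clear; lia. Qed.

Lemma np_ge1 : 1 <= n%:R * p.
Proof.
apply: ler_of_sqr; first by rewrite mulr_ge0 ?(ltW p0).
by rewrite expr1n; apply: le_trans np_sqr_ge.
Qed.

Lemma val_iter_ordS l (i : 'I_l) m : val (iter m (@ordS l) i) = ((i + m) %% l)%N.
Proof.
elim: m => [|m IH]; first by rewrite addn0 modn_small.
by rewrite iterS /= IH -addn1 modnDml addn1 addnS.
Qed.

Lemma ordS_closed l (J : {set 'I_l}) : J != set0 -> (forall i, i \in J -> ordS i \in J) -> J = setT.
Proof.
move=> /set0Pn[i iJ] cl; apply/setP => j; rewrite inE.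
have h m : iter m (@ordS l) i \in J by elim: m => //= m; apply: cl.
(* The number of steps is [j - i] modulo [l], written so that the subtraction does not truncate. *)
have -> : j = iter (j + (l - i)) (@ordS l) i; last exact: h.
apply: val_inj; rewrite val_iter_ordS addnCA subnKC; last exact/ltnW/ltn_ord.
by rewrite modnDr modn_small.
Qed.

Lemma card_C_graph l : (#|C_graph l| <= l)%N.
Proof. by apply: leq_trans (leq_imset_card _ _) _; rewrite card_ord. Qed.

Lemma C_graph_is_graph l : (1 < l)%N -> is_graph (C_graph l).
Proof.
move=> l1; apply/subsetP => _ /imsetP[i _ ->]; rewrite inE cards2.
suff -> : i != ordS i by [].
apply/negP => /eqP/(congr1 val) /= h.
have := ltn_ord i; rewrite leq_eqVlt => /orP[/eqP il|il].
  by rewrite il modnn in h; move: il; rewrite h; move: l1; clear; lia.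
by rewrite modn_small // in h; move: h; clear; lia.
Qed.

Lemma C_graph_neq0 l : (0 < l)%N -> C_graph l != set0.
Proof.
move=> l0; apply/set0Pn; exists [set Ordinal l0; ordS (Ordinal l0)].
exact: imset_f.
Qed.

(** Index the edges of the cycle by their first end. Some [i] in [J] has its successor outside, so
    [i] indexes no edge inside [J]. *)
Lemma card_induced_C l (J : {set 'I_l}) : J != set0 -> J != setT ->
  (#|induced (C_graph l) J| < #|J|)%N.
Proof.
move=> J0 JT; have [i iJ iS] : exists2 i, i \in J & ordS i \notin J.
  apply: contrapT => no; move/eqP: JT; apply; apply: ordS_closed => // i iJ.
  by apply: contrapT => /negP iS; apply: no; exists i.
apply: (@leq_ltn_trans #|J :\ i|); last by rewrite [X in (_ < X)%N](cardsD1 i) iJ.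
apply: (@leq_trans #|[set ([set x; ordS x] : {set 'I_l}) | x in J :\ i]|); last exact: leq_imset_card.
apply/subset_leq_card/subsetP => e; rewrite inE => /andP[/imsetP[x _ ->]].
rewrite subUset !sub1set => /andP[xJ xS]; apply: imset_f; rewrite !inE xJ andbT.
by apply: contraTneq xS => ->.
Qed.

(** A proper subset of [j] vertices spans at most [j - 1] edges, and
    [n^j p^(j-1) = n^2 p (n p)^(j-2)]. For the whole cycle the cofactor of [n^2 p] is
    [n^(l-2) p^(l-1)], whose square is at least [(n^2 p^3)^(l-2) >= L], as [t >= 4]. *)
Lemma balanced_C l : (5 <= l)%N -> balanced (C_graph l) n p (n%:R ^+ 2 * p).
Proof.
move=> l5 J J0.
have j2 : (1 < #|J|)%N.
  case/set0Pn: J0 => e; rewrite inE => /andP[eC eJ].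
  have := subsetP (C_graph_is_graph (leq_trans _ l5)) e eC; rewrite inE => /(_ isT)/eqP <-.
  exact: subset_leq_card.
have [JT|JT] := eqVneq J setT.
  have jl : #|J| = l by rewrite JT cardsT card_ord.
  apply: (@le_trans _ _ (n%:R ^+ l * p ^+ l)); last first.
    rewrite jl; apply: ler_wpM2l; first by rewrite exprn_ge0.
    apply: ler_wiXn2l; rewrite ?(ltW p0) //; apply: leq_trans (card_C_graph l).
    by apply/subset_leq_card/subsetP => e; rewrite inE => /andP[].
  have -> : n%:R ^+ l * p ^+ l = n%:R ^+ 2 * p * (n%:R ^+ (l - 2) * p ^+ (l - 1)).
    by rewrite mulrACA -exprD -exprS; congr (n%:R ^+ _ * p ^+ _); move: l5; clear; lia.
  rewrite ler_peMr ?mulr_ge0 ?exprn_ge0 ?(ltW p0) //.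
  apply: ler_of_sqr; first by rewrite mulr_ge0 ?exprn_ge0 ?(ltW p0).
  rewrite expr1n exprMn -!exprM; apply: (@le_trans _ _ ((n%:R ^+ 2 * p ^+ 3) ^+ (l - 2))).
    apply: le_trans L1 _; apply: scale_expr_ge; move: t4 l5; clear; lia.
  rewrite exprMn -!exprM mulnC; apply: ler_wpM2l; first by rewrite exprn_ge0.
  by apply: ler_wiXn2l; rewrite ?(ltW p0) //; move: l5; clear; lia.
have J0' : J != set0 by rewrite -card_gt0 ltnW.
have ij := card_induced_C J0' JT.
apply: (@le_trans _ _ (n%:R ^+ #|J| * p ^+ (#|J| - 1))); last first.
  apply: ler_wpM2l; first by rewrite exprn_ge0.
  by apply: ler_wiXn2l; rewrite ?(ltW p0) //; move: ij; case: #|J| => // m; rewrite subn1.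
have -> : n%:R ^+ #|J| * p ^+ (#|J| - 1) = n%:R ^+ 2 * p * (n%:R * p) ^+ (#|J| - 2).
  rewrite exprMn mulrACA -exprD -exprS; congr (n%:R ^+ _ * p ^+ _); move: #|J| j2; clear; lia.
rewrite ler_peMr ?mulr_ge0 ?exprn_ge0 ?(ltW p0) //.
by apply: exprn_ege1; exact: np_ge1.
Qed.

End Threshold.

(** * Numbers of edges in G(n,p) *)

Lemma npairs_le_cap (V : finType) (E : {set {set V}}) (S T : {set V}) :
  (forall d, d \in E -> #|d| == 2%N) ->
  (npairs (adj E) S T <= 2 * #|E :&: [set [set xy.1; xy.2] | xy in setX S T]|)%N.
Proof.
move=> E2; set A := [set _ | _ in _]; rewrite /npairs -sum1_card.
rewrite (partition_big (fun xy : V * V => [set xy.1; xy.2]) (mem (E :&: A))) /=; last first.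
  move=> [x y]; rewrite inE => /andP[xy xyE]; rewrite inE; apply/andP; split; first exact: xyE.
  exact: (imset_f (fun xy : V * V => [set xy.1; xy.2]) xy).
rewrite mulnC -sum_nat_const; apply: leq_sum => d; rewrite inE => /andP[dE _].
rewrite sum1_card -(card_ends (E2 d dE)); apply/subset_leq_card/subsetP => xy.
by rewrite !inE => /andP[_ ->].
Qed.

Lemma card_edges_whp (eps : R) : 0 < eps ->
  exists2 M : R, 0 < M & forall n (p : R), 0 < p -> p <= 1 -> M <= n%:R ^+ 2 * p ->
    Pr p (edges_of n) (fun E => ~ (#|E|%:R <= 4 * (n%:R ^+ 2 * p))) <= eps.
Proof.
move=> e0; exists eps^-1 => [|n p p0 p1 Mn]; first by rewrite invr_gt0.
have h := Pr_card_ge (ltW p0) p1 (4 * (n%:R ^+ 2 * p)) (subxx (edges_of n)).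
apply: (@le_trans _ _ (Pr p (edges_of n) (fun E => 4 * (n%:R ^+ 2 * p) <= #|E :&: edges_of n|%:R))).
  apply: Pr_le => //; rewrite ?(ltW p0) // => E EU; rewrite (setIidPl EU) => /negP.
  by rewrite -ltNge => /ltW.
apply: (le_trans h); apply: le_trans (expRN_inv_le e0); rewrite ler_expR.
have En : #|edges_of n|%:R <= n%:R ^+ 2 :> R by rewrite -natrX ler_nat card_edges_le.
have := ler_wpM2l (ltW p0) En; move: Mn; rewrite [p * n%:R ^+ 2]mulrC.
move: (n%:R ^+ 2 * p) (p * _) (eps^-1) => a b c; lra.
Qed.

(** At least [delta n p #|S| / 2] edges would have to join [S] to [T], while at most a quarter of
    that is expected. The failure exponent, of order [(n p)^2], must beat the [4^n] pairs [(S, T)];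
    hence the condition on [n p^2]. *)
Lemma npairs_whp (delta kappa eps : R) : 0 < delta -> 0 < kappa -> 0 < eps ->
  exists2 M : R, 0 < M & forall n (p : R), 0 < p -> p <= 1 -> M <= n%:R * p ^+ 2 ->
    Pr p (edges_of n) (fun E => ~ forall S T : {set 'I_n},
      kappa * (n%:R * p) <= #|S|%:R -> #|T|%:R <= delta / 8 * n%:R ->
      (npairs (adj E) S T)%:R < delta * (n%:R * p) * #|S|%:R) <= eps.
Proof.
move=> d0 k0 e0.
have M0 : 0 < 8 / (delta * kappa) * (2 + eps^-1).
  by apply: mulr_gt0; [apply: divr_gt0 => //; exact: mulr_gt0|apply: addr_gt0; rewrite // invr_gt0].
exists (8 / (delta * kappa) * (2 + eps^-1)) => // n p p0 p1 Mn.
have np0 : 0 < n%:R * p ^+ 2 by apply: lt_le_trans Mn.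
have n0' : 0 < n%:R :> R by rewrite -(pmulr_lgt0 _ (exprn_gt0 2 p0)).
have n1 : 1 <= n%:R :> R by rewrite ler1n -(ltr0n R).
pose B (ST : {set 'I_n} * {set 'I_n}) := (kappa * (n%:R * p) <= #|ST.1|%:R) && (#|ST.2|%:R <= delta / 8 * n%:R).
pose M (ST : {set 'I_n} * {set 'I_n}) : {set {set 'I_n}} :=
  edges_of n :&: [set [set xy.1; xy.2] | xy in setX ST.1 ST.2].
pose A (ST : {set 'I_n} * {set 'I_n}) (E : {set {set 'I_n}}) :=
  delta * (n%:R * p) * #|ST.1|%:R / 2 <= #|E :&: M ST|%:R.
apply: (@le_trans _ _ (Pr p (edges_of n) (fun E => exists2 ST, B ST & A ST E))).
  apply: Pr_le => //; rewrite ?(ltW p0) // => E EU hE; apply: contrapT => no; apply: hE => S T hS hT.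
  rewrite ltNge; apply/negP => hp; apply: no; exists (S, T); first by rewrite /B hS.
  have E2 d : d \in E -> #|d| == 2%N by move/(subsetP EU); rewrite inE.
  have := npairs_le_cap S T E2; rewrite -(ler_nat R) natrM => hc.
  rewrite /A /M /= setIA (setIidPl EU); lra.
apply: le_trans (Pr_exists _ _ _ _ _) _; rewrite ?(ltW p0) //.
apply: (@le_trans _ _ (\sum_(ST : {set 'I_n} * {set 'I_n}) expR (- (delta * kappa / 8 * (n%:R * p) ^+ 2)))).
  rewrite big_mkcond; apply: ler_sum => -[S T] _; case: ifP => [/andP[/= hS hT]|_]; last exact: expR_ge0.
  have MU : M (S, T) \subset edges_of n by apply: subsetIl.
  apply: (le_trans (Pr_card_ge (ltW p0) p1 _ MU)); rewrite ler_expR /=.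
  have cM : #|M (S, T)|%:R <= #|S|%:R * #|T|%:R :> R.
    rewrite -natrM ler_nat -cardsX; apply: leq_trans (leq_imset_card _ _).
    by apply: subset_leq_card; apply: subsetIr.
  have h1 : p * #|M (S, T)|%:R <= p * (#|S|%:R * (delta / 8 * n%:R)).
    apply: ler_wpM2l; first exact: ltW.
    by apply: (le_trans cM); apply: ler_wpM2l.
  have h2 : delta / 8 * (n%:R * p) * (kappa * (n%:R * p)) <= delta / 8 * (n%:R * p) * #|S|%:R.
    by apply: ler_wpM2l => //; apply: mulr_ge0; [apply: divr_ge0; rewrite // ltW|apply: mulr_ge0; rewrite // ltW].
  have -> : delta * kappa / 8 * (n%:R * p) ^+ 2 = delta / 8 * (n%:R * p) * (kappa * (n%:R * p)) by ring.
  move: h1 h2; move: (#|M (S, T)|%:R) (#|S|%:R) (n%:R : R) => a b c h1 h2.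
  have e1 : p * (b * (delta / 8 * c)) = delta / 8 * (c * p) * b by ring.
  rewrite e1 in h1.
  have -> : delta * (c * p) * b / 2 / 2 = 2 * (delta / 8 * (c * p) * b) by field.
  lra.
rewrite sumr_const card_prod -[#|{: {set 'I_n}}|]cardsT -powersetT card_powerset cardsT card_ord -expnD.
rewrite -[leLHS]mulr_natl.
apply: le_trans (ler_wpM2r (expR_ge0 _) (natr_exp2_le _ _)) _; rewrite -expRD.
apply: le_trans (expRN_inv_le e0); rewrite ler_expR.
have h1 : (2 + eps^-1) * n%:R <= delta * kappa / 8 * (n%:R * p) ^+ 2.
  have -> : delta * kappa / 8 * (n%:R * p) ^+ 2 = delta * kappa / 8 * (n%:R * p ^+ 2) * n%:R by ring.
  apply: ler_wpM2r; first exact: ltW.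
  have h0 : 0 <= delta * kappa / 8 by apply: divr_ge0 => //; apply: mulr_ge0; exact: ltW.
  apply: le_trans (ler_wpM2l h0 Mn).
  by rewrite le_eqVlt; apply/orP; left; apply/eqP; field; rewrite !gt_eqF.
have h2 : eps^-1 <= eps^-1 * n%:R by rewrite ler_peMr ?invr_ge0 ?(ltW e0).
rewrite natrD; lra.
Qed.

End Balance.

(** * Hubs and odd cycles *)

Section GraphTools.
Variables (R : realType) (V : finType).
Implicit Types (e : rel V) (A B P Q X : {set V}).

Lemma npairsC e A B : symmetric e -> npairs e A B = npairs e B A.
Proof.
move=> se; rewrite !npairs_sum.
have h x (C : {set V}) : #|nbr e x C| = (\sum_(y in C) e x y)%N.
  rewrite -sum1_card big_mkcond [RHS]big_mkcond /=; apply: eq_bigr => y _.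
  by rewrite inE; case: (y \in C); case: (e x y).
under eq_bigr do rewrite h; rewrite exchange_big /=.
by apply: eq_bigr => y _; rewrite h; apply: eq_bigr => x _; rewrite se.
Qed.

Lemma npairs_rem e A B a : a \in A -> npairs e A B = (#|nbr e a B| + npairs e (A :\ a) B)%N.
Proof. by move=> aA; rewrite !npairs_sum (big_setD1 a). Qed.

(** Remove vertices of degree below [th] one by one: each removal destroys fewer than [th] pairs, so
    the process stops with pairs left. *)
Lemma exists_mindeg e A B (th : R) : symmetric e -> 0 <= th ->
  th * (#|A| + #|B|)%:R < (npairs e A B)%:R ->
  exists A' B', [/\ A' \subset A, B' \subset B, A' != set0,
    forall a, a \in A' -> th <= #|nbr e a B'|%:R & forall b, b \in B' -> th <= #|nbr e b A'|%:R].
Proof.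
move=> se th0; have [m] := ubnP (#|A| + #|B|)%N; elim: m A B => // m IH A B mAB hAB.
have [[a aA ha]|noA] := pselect (exists2 a, a \in A & #|nbr e a B|%:R < th).
  have cA : (#|A| = #|A :\ a|.+1)%N by rewrite (cardsD1 a A) aA.
  have [||A' [B' [AA BB A0 h1 h2]]] := IH (A :\ a) B.
  - by move: mAB; rewrite cA.
  - by move: hAB; rewrite (npairs_rem _ _ aA) cA addSn -addn1 !natrD mulrDr mulr1; lra.
  exists A', B'; split=> //; exact: subset_trans AA (subsetDl _ _).
have [[b bB hb]|noB] := pselect (exists2 b, b \in B & #|nbr e b A|%:R < th).
  have cB : (#|B| = #|B :\ b|.+1)%N by rewrite (cardsD1 b B) bB.
  have [||A' [B' [AA BB A0 h1 h2]]] := IH A (B :\ b).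
  - by move: mAB; rewrite cB addnS.
  - move: hAB; rewrite (npairsC _ _ se) (npairs_rem _ _ bB) (npairsC _ _ se).
    by rewrite cB addnS -addn1 !natrD mulrDr mulr1; lra.
  exists A', B'; split=> //; exact: subset_trans BB (subsetDl _ _).
exists A, B; split=> //.
- apply: contraTneq hAB => ->; rewrite npairs_sum big_set0 -leNgt.
  by rewrite mulr_ge0.
- by move=> a aA; rewrite leNgt; apply/negP => ha; apply: noA; exists a.
- by move=> b bB; rewrite leNgt; apply/negP => hb; apply: noB; exists b.
Qed.

(* In a hub of large minimum degree any two vertices of [P] are joined, via [z], by a path
   of every even length from 4 on, so an edge inside [P] closes odd cycles. *)
Definition hub e (th : R) (z : V) P Q : Prop :=
  [/\ Q \subset nbr e z setT, forall a, a \in P -> th <= #|nbr e a Q|%:R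
    & forall b, b \in Q -> th <= #|nbr e b P|%:R].

(* Double counting of the paths [w, x, z] with [w] in [X], and convexity, provide [z]. *)
Lemma exists_hub e X (c : R) : symmetric e -> 0 < c ->
  c * #|V|%:R ^+ 2 < (npairs e X setT)%:R ->
  exists z P Q, [/\ P \subset X, P != set0 & hub e (c ^+ 2 / 4 * #|V|%:R) z P Q].
Proof.
move=> se c0 hX; set n : R := #|V|%:R in hX *.
pose dX x : R := #|nbr e x X|%:R.
have SX : \sum_x dX x = (npairs e X setT)%:R.
  rewrite (npairsC _ _ se) npairs_sum natr_sum; apply: eq_bigl => x; by rewrite inE.
have n0 : 0 < n.
  rewrite lt_neqAle ler0n andbT; apply: contraTneq hX => n0.
  rewrite -n0 expr0n mulr0 -leNgt.
  have -> : npairs e X setT = 0%N.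
    apply/eqP; rewrite cards_eq0; apply/eqP/setP => -[x y]; rewrite !inE.
    have : #|V| = 0%N by apply/eqP; rewrite -(eqr_nat R) -/n -n0.
    by move/card0_eq/(_ x); rewrite inE.
  by [].
have trip : \sum_z (npairs e X (nbr e z setT))%:R = \sum_x dX x * #|nbr e x setT|%:R.
  rewrite (eq_bigr (fun z => \sum_(x | e z x) dX x)).
    rewrite (exchange_big_dep xpredT) //=; apply: eq_bigr => x _.
    rewrite sumr_const -[LHS]mulr_natr; congr (_ * _%:R).
    by apply: eq_card => z; rewrite !inE /= se.
  move=> z _; rewrite (npairsC _ _ se) npairs_sum natr_sum.
  by apply: eq_bigl => x; rewrite !inE.
have sq : c ^+ 2 * n ^+ 2 * n <= \sum_z (npairs e X (nbr e z setT))%:R.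
  (* Convexity in the form of the tangent line of the square at [c * n]. *)
  rewrite trip; apply: (@le_trans _ _ (\sum_x (2 * (c * n) * dX x - (c * n) ^+ 2))).
    rewrite sumrB -big_distrr /= SX sumr_const -[_ *+ #|_|]mulr_natr -/n.
    have h0 : 0 <= 2 * (c * n) by rewrite mulr_ge0 // mulr_ge0 // ltW.
    have := ler_wpM2l h0 (ltW hX); rewrite (_ : _ * (c * n ^+ 2) = 2 * (c ^+ 2 * n ^+ 2 * n)); last by ring.
    by rewrite (_ : (c * n) ^+ 2 * n = c ^+ 2 * n ^+ 2 * n); [lra|ring].
  apply: ler_sum => x _; have d01 : dX x <= #|nbr e x setT|%:R.
    by rewrite ler_nat; apply/subset_leq_card/subsetP => y; rewrite !inE => /andP[_ ->].
  have d00 : 0 <= dX x by rewrite ler0n.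
  have := ler_wpM2l d00 d01; have := sqr_ge0 (dX x - c * n).
  by rewrite sqrrB -mulr_natr; move: (dX x * dX x) (expr2 (dX x)) => w <-; lra.
have [z hz] : exists z, c ^+ 2 * n ^+ 2 <= (npairs e X (nbr e z setT))%:R.
  apply: contrapT => no; move: sq; apply/negP; rewrite -ltNge.
  have [z0 _] : exists z0 : V, true.
    have : (0 < #|V|)%N by rewrite -(ltr0n R).
    by move/card_gt0P => [z0 _]; exists z0.
  have -> : c ^+ 2 * n ^+ 2 * n = \sum_(z : V) c ^+ 2 * n ^+ 2.
    by rewrite sumr_const -[RHS]mulr_natr.
  apply: ltr_sum => [|z _]; first by apply/hasP; exists z0; rewrite ?mem_index_enum.
  by rewrite ltNge; apply/negP => h; apply: no; exists z.
have g0 : 0 <= c ^+ 2 / 4 * n by rewrite mulr_ge0 ?divr_ge0 ?exprn_ge0 // ltW.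
have [|P [Q [PX QN P0 h1 h2]]] := @exists_mindeg e X (nbr e z setT) (c ^+ 2 / 4 * n) se g0.
  apply: lt_le_trans hz; apply: (@le_lt_trans _ _ (c ^+ 2 / 4 * n * (n + n))).
    by apply: ler_wpM2l => //; rewrite natrD lerD // ler_nat max_card.
  have : 0 < c ^+ 2 * n ^+ 2 by rewrite mulr_gt0 ?exprn_gt0.
  by rewrite (_ : c ^+ 2 / 4 * n * (n + n) = c ^+ 2 * n ^+ 2 / 2); [lra|field].
by exists z, P, Q.
Qed.

(** [z] is removed because the cycle of [hub_cycle] passes through it besides its edge in [P];
    [2 <= th] absorbs the loss of one vertex. *)
Lemma hub_card e th z P Q : P != set0 -> 2 <= th -> hub e th z P Q -> th / 2 <= #|P :\ z|%:R.
Proof.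
move=> /set0Pn[a aP] th2 [_ hP hQ].
have /card_gt0P[b] : (0 < #|nbr e a Q|)%N.
  by rewrite -(ltr0n R); apply: lt_le_trans (hP a aP); lra.
rewrite inE => /andP[/hQ hb _].
have Pb : th <= #|P|%:R.
  apply: (le_trans hb); rewrite ler_nat; apply/subset_leq_card/subsetP => y.
  by rewrite inE => /andP[].
have : #|P|%:R <= #|P :\ z|%:R + 1 :> R.
  rewrite natr1 ler_nat (cardsD1 z P); by case: (z \in P).
lra.
Qed.

Lemma pick_fresh A (s : seq V) : (size s < #|A|)%N -> exists2 x, x \in A & x \notin s.
Proof.
move=> sA; apply: contrapT => no; move: sA; apply/negP; rewrite -leqNgt.
apply: leq_trans (card_size s); apply/subset_leq_card/subsetP => x xA.
by apply: contrapT => /negP xs; apply: no; exists x.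
Qed.

(** Greedy choice: each vertex has at least [l] neighbours on the other side, while the vertices to
    avoid and those to be chosen number at most [l] together. *)
Lemma hub_zigzag e l z P Q k x (av : seq V) : hub e l%:R z P Q ->
  (size av + 2 * k <= l)%N -> x \in P ->
  exists s, [/\ size s = (2 * k)%N, path e x s, last x s \in P, uniq s & forall v, v \in s -> v \notin av].
Proof.
move=> [_ hP hQ]; elim: k x av => [|k IH] x av sz xP; first by exists [::].
have [q] : exists2 q, q \in nbr e x Q & q \notin av.
  apply: pick_fresh; have := hP x xP; rewrite ler_nat; apply: leq_trans.
  by move: sz; clear; lia.
rewrite inE => /andP[qQ xq] qav.
have [y] : exists2 y, y \in nbr e q P & y \notin q :: av.
  apply: pick_fresh; have := hQ q qQ; rewrite ler_nat; apply: leq_trans.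
  by move: sz; rewrite /=; clear; lia.
rewrite inE => /andP[yP qy] yav.
have [|s [ss ps ls us fs]] := IH y [:: y, q & av] _ yP.
  by move: sz; rewrite /=; clear; lia.
exists [:: q, y & s]; split=> //=.
- by rewrite ss; clear; lia.
- by rewrite xq qy.
- rewrite inE negb_or us andbT; apply/andP; split.
    apply/andP; split; first by move: yav; rewrite inE negb_or eq_sym => /andP[].
    by apply/negP => /fs; rewrite !inE eqxx orbT.
  by apply/negP => /fs; rewrite !inE eqxx.
- move=> v; rewrite !inE => /or3P[/eqP->|/eqP->|/fs].
  + exact: qav.
  + by move: yav; rewrite inE negb_or => /andP[].
  + by rewrite !inE !negb_or => /and3P[].
Qed.

(** The cycle is [y, x], then a zigzag of [2 * k] vertices ending in [P], then [q, z, q'] and back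
    to [y]. It has [2 * k + 5] vertices, and [k = 0] gives the shortest case [l = 5]. *)
Lemma hub_cycle e l z P Q x y : symmetric e -> irreflexive e -> odd l -> (5 <= l)%N ->
  hub e l%:R z P Q -> x \in P -> y \in P -> x != z -> y != z -> e x y ->
  exists s, [/\ size s = l, uniq s & cycle e s].
Proof.
move=> se ie lo l5 hb xP yP xz yz xy.
have [k lk] : exists k, l = (2 * k + 5)%N.
  exists ((l - 5)./2); rewrite mul2n halfK oddB // lo /= subn0 subnK //.
have xyn : x != y by apply: contraTneq xy => ->; rewrite ie.
have [|s [ss ps ls us fs]] := @hub_zigzag e l z P Q k x [:: x; y; z] hb _ xP.
  by rewrite lk /=; clear; lia.
have [hz hP hQ] := hb.
have [q] : exists2 q, q \in nbr e (last x s) Q & q \notin [:: x, y, z & s].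
  apply: pick_fresh; have := hP _ ls; rewrite ler_nat; apply: leq_trans.
  by rewrite /= ss lk; clear; lia.
rewrite inE => /andP[qQ lq] qav.
have [q'] : exists2 q', q' \in nbr e y Q & q' \notin [:: q, x, y, z & s].
  apply: pick_fresh; have := hP _ yP; rewrite ler_nat; apply: leq_trans.
  by rewrite /= ss lk; clear; lia.
rewrite inE => /andP[q'Q yq'] q'av.
have zq : e z q by have := subsetP hz q qQ; rewrite inE => /andP[].
have zq' : e z q' by have := subsetP hz q' q'Q; rewrite inE => /andP[].
exists [:: y, x & s ++ [:: q; z; q']]; split.
- by rewrite /= size_cat ss lk /=; clear; lia.
- have fx : x \notin s by apply/negP => /fs; rewrite !inE eqxx.
  have fy : y \notin s by apply/negP => /fs; rewrite !inE eqxx orbT.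
  have fz : z \notin s by apply/negP => /fs; rewrite !inE eqxx !orbT.
  move: qav q'av; rewrite !inE !negb_or => /and4P[qx qy qz qs] /and5P[q'q q'x q'y q'z q's].
  rewrite /= cat_uniq us /= !(inE, mem_cat) !negb_or.
  rewrite (eq_sym y x) xyn fy (eq_sym y q) qy yz (eq_sym y q') q'y fx (eq_sym x q) qx xz (eq_sym x q') q'x.
  by rewrite qs fz q's qz (eq_sym q q') q'q (eq_sym z q') q'z.
- rewrite /= rcons_cat cat_path /= (se y x) xy ps lq (se q z) zq zq' /=.
  by rewrite (se q' y) yq'.
Qed.

Lemma paths_cycle e u q1 q2 : symmetric e ->
  path e u q1 -> path e u q2 -> uniq (u :: q1 ++ q2) -> e (last u q1) (last u q2) ->
  cycle e (u :: q1 ++ rev q2) /\ uniq (u :: q1 ++ rev q2).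
Proof.
move=> se p1 p2 un ee; split; last first.
  rewrite -(perm_uniq (s1 := u :: q1 ++ q2)) // perm_cons perm_cat2l.
  by rewrite perm_sym perm_rev.
rewrite /= rcons_cat cat_path p1 /= -rev_cons lastI rev_rcons /= ee /= rev_path.
by rewrite (eq_path (e' := e)) // => a b; rewrite se.
Qed.

End GraphTools.

Lemma cycle_contains_copy n (S : {set {set 'I_n}}) (s : seq 'I_n) :
  uniq s -> cycle (adj S) s -> contains_copy (C_graph (size s)) S.
Proof.
case: s => [|x p] us cs.
  exists (fun i : 'I_0 => match i with Ordinal m h => False_rect _ (Bool.diff_false_true h) end).
  by split=> [[]|e /imsetP[[]]].
exists (fun i => nth x (x :: p) i); split.
  by move=> i j /eqP; rewrite nth_uniq // => /eqP/val_inj.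
move=> _ /imsetP[i _ ->]; rewrite imsetU !imset_set1.
have /pathP := cs => /(_ x i); rewrite size_rcons ltn_ord => /(_ isT).
rewrite /adj; congr ([set _; _] \in S).
  by rewrite -rcons_cons nth_rcons /= ltn_ord.
rewrite nth_rcons /=; case: ltnP => hi; first by rewrite modn_small.
have -> : nat_of_ord i = size p by apply/eqP; rewrite eqn_leq hi andbT -ltnS ltn_ord.
by rewrite eqxx modnn.
Qed.

(** * Disjoint search trees *)

Section Branching.
Variables (R : realType) (V : finType) (e : rel V).
Hypothesis se : symmetric e.
Implicit Types (A B T X P : {set V}) (u : V).

Lemma exists_subset_card A a : (a <= #|A|)%N -> exists2 B : {set V}, B \subset A & #|B| = a.
Proof.
move=> aA; exists [set x in take a (enum A)].
  by apply/subsetP => x; rewrite inE => /mem_take; rewrite mem_enum.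
rewrite cardsE; have /card_uniqP -> := take_uniq a (enum_uniq (mem A)).
by rewrite size_takel // -cardE.
Qed.

Lemma exists_disjoint_subsets A a m : (m * a <= #|A|)%N ->
  exists L : nat -> {set V}, [/\ forall i, (i < m)%N -> L i \subset A,
    forall i, (i < m)%N -> #|L i| = a & forall i j, (i < m)%N -> (j < m)%N -> i != j -> [disjoint L i & L j]].
Proof.
elim: m A => [|m IH] A mA; first by exists (fun=> set0).
have [|B BA cB] := @exists_subset_card A a; first by apply: leq_trans mA; rewrite mulSn leq_addr.
have [|L [LA cL dL]] := IH (A :\: B).
  by rewrite cardsD (setIidPr BA) cB; move: mA; rewrite mulSn; clear; lia.
have LB i : (i < m)%N -> [disjoint L i & B].
  by move=> im; have := LA i im; rewrite subsetD => /andP[].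
exists (fun i => if (i < m)%N then L i else B); split=> [i im|i im|i j im jm ij].
- case: ifP => // him; exact: subset_trans (LA i him) (subsetDl _ _).
- by case: ifP => // /cL.
- case: ifP => hi; case: ifP => hj; [exact: dL|exact: LB|by rewrite disjoint_sym LB|].
  by exfalso; move: hi hj im jm ij; clear; lia.
Qed.

(* [T] lies at distance [j] from [u] along paths running inside [B]. *)
Definition branch u B T (j : nat) : Prop := [/\ u \notin B, T \subset B &
  forall x, x \in T -> exists q, [/\ path e u q, last u q = x, uniq q, {subset q <= B} & size q = j]].

(** Abstract form of [npairs_whp]: [a], of order [n p], is the least size at which expansion
    applies, [b] is the linear size of the later levels, and [C] bounds the room that all trees may
    occupy. *)
Variables (beta : R) (a b C : nat) (X : {set V}).
Hypothesis Xdeg : forall x, x \in X -> beta <= #|nbr e x X|%:R.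
Hypothesis expand : forall S T : {set V}, (a <= #|S|)%N -> (#|T| <= C)%N ->
  (npairs e S T)%:R < beta * #|S|%:R.
Hypothesis ab : (a <= b)%N.

(** If fewer than [b] fresh neighbours were available, [T] would send all its [beta * #|T|] pairs
    into a set of at most [C] vertices, against [expand]. [P] holds the vertices reserved for other
    trees. *)
Lemma branch_grow u B T P j : branch u B T j -> T \subset X -> (a <= #|T|)%N ->
  [disjoint B & P] -> (#|B| + #|P| + 1 + b <= C)%N ->
  exists T', [/\ T' \subset X, #|T'| = b, branch u (B :|: T') T' j.+1 & [disjoint B :|: T' & P]].
Proof.
move=> [uB TB hT] TX aT BP szC.
pose N := [set y in X | [exists x in T, e x y]] :\: (u |: (B :|: P)).
have bN : (b <= #|N|)%N.
  rewrite leqNgt; apply/negP => Nb.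
  have szU : (#|N :|: (u |: (B :|: P))| <= C)%N.
    apply: leq_trans (leq_card_setU _ _) _; apply: leq_trans (leq_add (leqnn _) (leq_card_setU _ _)) _.
    rewrite cards1; apply: leq_trans (leq_add (leqnn _) (leq_add (leqnn _) (leq_card_setU _ _))) _.
    by move: szC Nb; clear; lia.
  have := expand aT szU; apply/negP; rewrite -leNgt npairs_sum natr_sum.
  apply: (@le_trans _ _ (\sum_(x in T) beta)).
    by rewrite sumr_const -[leRHS]mulr_natr.
  apply: ler_sum => x xT; apply: le_trans (Xdeg (subsetP TX x xT)) _.
  rewrite ler_nat; apply/subset_leq_card/subsetP => y; rewrite inE => /andP[yX xy].
  rewrite inE xy andbT inE; case: (boolP (y \in u |: (B :|: P))); rewrite ?orbT // orbF => yn.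
  rewrite inE yn inE yX; apply/existsP; exists x; by rewrite xT.
have [T' TN cT] := exists_subset_card bN.
have TU y : y \in T' -> [/\ y \in X, y != u, y \notin B, y \notin P & [exists x in T, e x y]].
  move/(subsetP TN); rewrite !inE !negb_or => /andP[/andP[yu /andP[yB yP]] /andP[yX yT]].
  by split.
exists T'; split=> //.
- by apply/subsetP => y /TU[].
- split; first by rewrite inE (negbTE uB); apply/negP => /TU[_ /eqP].
    exact: subsetUr.
  move=> y yT; have [_ yu yB yP /existsP[x /andP[xT xy]]] := TU y yT.
  have [q [pq lq uq qB sq]] := hT x xT.
  exists (rcons q y); split.
  + by rewrite rcons_path pq lq.
  + by rewrite last_rcons.
  + by rewrite rcons_uniq uq andbT; apply/negP => /qB; rewrite (negbTE yB).
  + by move=> v; rewrite mem_rcons !inE => /orP[/eqP->|/qB->]; rewrite ?yT ?orbT.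
  + by rewrite size_rcons sq.
- rewrite disjoint_subset; apply/subsetP => v; rewrite !inE => /orP[vB|/TU[]//].
  by move: BP; rewrite disjoint_subset => /subsetP/(_ v vB).
Qed.

(** [L] is the first level, of size [a], followed by [r] levels of size [b]; hence the depth
    [r.+1]. *)
Lemma branch_levels u (L : {set V}) P r : u \notin L -> L \subset nbr e u X -> #|L| = a ->
  [disjoint L & P] -> (a + r * b + #|P| + 1 <= C)%N ->
  exists B T : {set V}, [/\ branch u B T r.+1, [disjoint B & P], (#|B| <= a + r * b)%N, T \subset X
    & (a <= #|T|)%N /\ ((0 < r)%N -> #|T| = b)] /\ L \subset B.
Proof.
move=> uL LN cL LP; elim: r => [|r IH] szC.
  exists L, L; split=> //; split=> //; rewrite ?cL ?addn0 //.
    split=> // x xL; exists [:: x]; split=> //=.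
      by have := subsetP LN x xL; rewrite inE andbT => /andP[].
    by move=> v; rewrite inE => /eqP->.
  by apply: subset_trans LN _; apply/subsetP => x; rewrite inE => /andP[].
have [|B [T [[br BP cB TX [aT _]] LB]]] := IH; first by move: szC; rewrite mulSn; clear; lia.
have [|T' [TX' cT' br' BP']] := branch_grow br TX aT BP.
  by move: szC cB; rewrite mulSn; clear; lia.
exists (B :|: T'), T'; split; last exact: subset_trans LB (subsetUl _ _).
split=> //; last by rewrite cT'.
apply: leq_trans (leq_card_setU _ _) _; rewrite cT' mulSn.
by move: cB; clear; lia.
Qed.

(** The trees are grown in turn. All first levels are cut out of the neighbourhood of [u] beforehand
    and kept out of the other trees, since a tree could otherwise swallow the neighbours of [u] that
    a later one starts from. *)
Lemma branches u (M r : nat) : u \in X -> ~~ e u u -> (0 < r)%N -> (M * a <= #|nbr e u X|)%N ->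
  (M.+1 * (a + r * b) + M * a + 1 <= C)%N ->
  exists B T : nat -> {set V},
    (forall i, (i < M)%N -> [/\ branch u (B i) (T i) r.+1, T i \subset X & #|T i| = b]) /\
    (forall i j, (i < M)%N -> (j < M)%N -> i != j -> [disjoint B i & B j]).
Proof.
move=> uX euu r0 Mdeg szC; have [L [LN cL dL]] := exists_disjoint_subsets Mdeg.
have uL i : (i < M)%N -> u \notin L i.
  by move=> iM; apply/negP => /(subsetP (LN i iM)); rewrite inE (negbTE euu) andbF.
suff H m : (m <= M)%N -> exists B T : nat -> {set V},
    [/\ forall i, (i < m)%N -> [/\ branch u (B i) (T i) r.+1, T i \subset X & #|T i| = b],
    forall i j, (i < m)%N -> (j < m)%N -> i != j -> [disjoint B i & B j],
    forall i, (i < m)%N -> (#|B i| <= a + r * b)%N &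
    forall i j, (i < m)%N -> (j < M)%N -> i != j -> [disjoint B i & L j]].
  by have [B [T [h1 h2 _ _]]] := H M (leqnn M); exists B, T.
elim: m => [|m IH] mM; first by exists (fun=> set0), (fun=> set0).
have [B [T [hB dB cB BL]]] := IH (ltnW mM).
pose P := (\bigcup_(i < m) B i) :|: (\bigcup_(j < M | (j : nat) != m) L j).
have cP : (#|P| <= M * (a + r * b) + M * a)%N.
  apply: leq_trans (leq_card_setU _ _) _; apply: leq_add.
    apply: (leq_trans (leq_card_bigcup _ _)).
    apply: (@leq_trans (\sum_(i < m) (a + r * b))); first by apply: leq_sum => i _; apply: cB.
    by rewrite sum_nat_const card_ord leq_mul2r (ltnW mM) orbT.
  apply: (leq_trans (leq_card_bigcup _ _)).
  apply: (@leq_trans (\sum_(i < M) a)); last by rewrite sum_nat_const card_ord.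
  by rewrite big_mkcond; apply: leq_sum => i _; case: ifP => // _; rewrite cL.
have LP : [disjoint L m & P].
  rewrite disjoint_subset; apply/subsetP => v vL; rewrite !inE negb_or; apply/andP; split.
    apply/negP => /bigcupP[i _ vB]; have := BL i m (ltn_ord i) mM.
    rewrite neq_ltn ltn_ord disjoint_subset => /(_ isT)/subsetP/(_ v vB).
    by rewrite inE vL.
  apply/negP => /bigcupP[j jm vj]; have := dL j m (ltn_ord j) mM jm.
  by rewrite disjoint_subset => /subsetP/(_ v vj); rewrite inE vL.
have [|B' [T' [[br BP cB' TX' [_ cT']] LB]]] := @branch_levels u (L m) P r (uL m mM) (LN m mM) (cL m mM) LP.
  by move: szC cP; rewrite mulSn; move: (M * _)%N (M * a)%N => w w'; clear; lia.
have BPi i : (i < m)%N -> [disjoint B' & B i].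
  move=> im; apply: disjointWr BP; apply: subset_trans (subsetUl _ _).
  exact: (bigcup_sup (Ordinal im)).
exists (fun i => if (i < m)%N then B i else B'), (fun i => if (i < m)%N then T i else T').
split=> [i im|i j im jm ij|i im|i j im jM ij].
- by case: ifP => him; [apply: hB|split=> //; apply: cT'].
- case: ifP => hi; case: ifP => hj; [exact: dB|by rewrite disjoint_sym BPi|exact: BPi|].
  by exfalso; move: hi hj im jm ij; clear; lia.
- by case: ifP => // /cB.
- case: ifP => hi; first exact: BL.
  have im' : i = m by move: hi im; clear; lia.
  apply: disjointWr BP; apply: subset_trans (subsetUr _ _).
  by apply: (bigcup_sup (Ordinal jM)); rewrite /= -im' eq_sym.
Qed.

Lemma branch_cycle u B1 B2 T1 T2 r x y : branch u B1 T1 r -> branch u B2 T2 r ->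
  [disjoint B1 & B2] -> x \in T1 -> y \in T2 -> e x y ->
  exists s, [/\ size s = (2 * r).+1, uniq s & cycle e s].
Proof.
move=> [u1 _ h1] [u2 _ h2] dB xT yT xy.
have [q1 [p1 l1 un1 s1 z1]] := h1 x xT.
have [q2 [p2 l2 un2 s2 z2]] := h2 y yT.
have [||cs us] := paths_cycle se p1 p2.
- rewrite /= mem_cat negb_or; apply/andP; split.
  + by apply/andP; split; [apply/negP => /s1|apply/negP => /s2]; rewrite ?(negbTE u1) ?(negbTE u2).
  + rewrite cat_uniq un1 un2 andbT; apply/hasPn => v v2; apply/negP => v1.
    move: dB; rewrite disjoint_subset => /subsetP/(_ v (s1 v v1)).
    by rewrite inE (s2 v v2).
- by rewrite l1 l2.
exists (u :: q1 ++ rev q2); split=> //.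
by rewrite /= size_cat size_rev z1 z2 mul2n addnn.
Qed.

End Branching.

(** * The colouring argument *)

Section Cliques.
Variable n : nat.
Implicit Types (S : {set {set 'I_n}}) (W : {set 'I_n}).

Definition clique S k W : Prop :=
  exists f : 'I_k -> 'I_n, [/\ injective f, forall i, f i \in W & forall i j, i != j -> adj S (f i) (f j)].

Lemma adj_irr S : is_graph S -> irreflexive (adj S).
Proof.
move=> SE x; apply/negP => /(subsetP SE); by rewrite inE setUid cards1.
Qed.

Lemma clique_copy S k W : clique S k W -> contains_copy (K_graph k) S.
Proof.
move=> [f [fi _ fS]]; exists f; split=> // e; rewrite inE => /cards2P[a [b [ab ->]]].
by rewrite imsetU !imset_set1; apply: fS.
Qed.

Lemma clique_extend S k W v : is_graph S -> clique S k W ->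
  (forall w, w \in W -> adj S v w) -> clique S k.+1 (v |: W).
Proof.
move=> SE [f [fi fW fS]] vW.
have fv i : f i != v.
  by apply/eqP => fiv; have := vW _ (fW i); rewrite fiv adj_irr.
pose g (i : 'I_k.+1) := if unlift ord0 i is Some j then f j else v.
exists g; split.
- move=> i j; rewrite /g; case: unliftP => [i'|] ->; case: unliftP => [j'|] -> //.
  + by move/fi ->.
  + by move/eqP; rewrite (negbTE (fv _)).
  + by move/esym/eqP; rewrite (negbTE (fv _)).
- by move=> i; rewrite /g !inE; case: unliftP => [i'|] _; rewrite ?fW ?orbT ?eqxx.
- move=> i j; rewrite /g; case: unliftP => [i'|] ->; case: unliftP => [j'|] ->.
  + by rewrite (inj_eq lift_inj); apply: fS.
  + by move=> _; rewrite adj_sym; apply: vW.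
  + by move=> _; apply: vW.
  + by rewrite eqxx.
Qed.

Lemma clique_sub S S' k W : clique S k W ->
  (forall x y, x \in W -> y \in W -> adj S x y -> adj S' x y) -> clique S' k W.
Proof.
move=> [f [fi fW fS]] h; exists f; split=> // i j ij.
by apply: h => //; apply: fS.
Qed.

Lemma transv_K (k : nat) (T : 'I_k -> {set 'I_n}) S : is_graph S ->
  transv (K_graph k) T S -> exists f : 'I_k -> 'I_n,
  [/\ injective f, forall i, f i \in T i & forall i j, i != j -> adj S (f i) (f j)].
Proof.
move=> SE [f [fT fS]].
have fadj i j : i != j -> adj S (f i) (f j).
  move=> ij; apply: (subsetP fS); apply/imsetP; exists [set i; j].
    by rewrite inE cards2 ij.
  by rewrite imsetU !imset_set1.
exists f; split=> // i j fij.
by apply/eqP; apply: contraTT isT => /fadj; rewrite fij adj_irr.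
Qed.

Lemma transv_copy (R : realType) (kappa : R) k (H : {set {set 'I_k}}) (T : 'I_k -> {set 'I_n}) S :
  spread kappa T -> transv H T S -> contains_copy H S.
Proof.
move=> [_ dT] [f [fT fS]]; exists f; split; last by move=> e eH; apply: (subsetP fS); apply: imset_f.
move=> i j fij; apply/eqP; apply: contraTT isT => /dT; rewrite disjoint_subset.
by move=> /subsetP/(_ (f i) (fT i)); rewrite inE fij fT.
Qed.

(** Cut [W] into [k] parts of size [#|W| %/ k]; the factor 2 in the new constant absorbs the
    rounding, as [2 k <= kappa n]. *)
Lemma exists_spread (R : realType) (kappa : R) k W : (0 < k)%N ->
  (2 * k)%:R <= kappa * n%:R -> kappa * n%:R <= #|W|%:R ->
  exists T : 'I_k -> {set 'I_n}, spread (kappa / (2 * k%:R)) T /\ (forall i, T i \subset W).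
Proof.
move=> k0 kn nW; have k0' : 0 < k%:R :> R by rewrite ltr0n.
have [|L [LW cL dL]] := @exists_disjoint_subsets _ W (#|W| %/ k) k.
  by rewrite mulnC leq_divM.
exists (fun i => L i); split; last by move=> i; apply: LW.
split=> [i|i j ij]; last by apply: dL.
rewrite cL // mulrAC ler_pdivrMr ?mulr_gt0 //.
have h1 : #|W|%:R < ((#|W| %/ k)%:R + 1) * k%:R :> R.
  by rewrite natr1 -natrM ltr_nat ltn_ceil.
have h2 : 2 * k%:R <= kappa * n%:R by rewrite -natrM.
by move: h1 h2 nW; rewrite mulrDl mul1r; move: (_ %/ _)%:R => q; rewrite mulrCA; lra.
Qed.

End Cliques.

(** * Red cliques forced by the absence of a blue cycle *)

Section Colouring.
Variables (R : realType) (n t l : nat) (p : R) (G E Red : {set {set 'I_n}}).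
Hypotheses (GE : is_graph G) (EE : is_graph E) (RedS : Red \subset G :|: E).
Hypotheses (t4 : (4 <= t)%N) (lo : odd l) (l5 : (5 <= l)%N) (p0 : 0 < p) (p1 : p <= 1).

Definition Blue := (G :|: E) :\: Red.
Hypothesis noC : ~ contains_copy (C_graph l) Blue.

Definition robust k (H : {set {set 'I_k}}) (kappa delta : R) : Prop :=
  forall (T : 'I_k -> {set 'I_n}) (D : {set {set 'I_n}}),
    spread kappa T -> D \subset E -> #|D|%:R <= delta * (n%:R ^+ 2 * p) -> transv H T (E :\: D).

Lemma Blue_graph : is_graph Blue.
Proof. by apply: subset_trans (subsetDl _ _) _; rewrite subUset GE EE. Qed.

Lemma Red_graph : is_graph Red.
Proof. by apply: subset_trans RedS _; rewrite subUset GE EE. Qed.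

Lemma no_blue_cycle (S : {set {set 'I_n}}) s : S \subset Blue -> size s = l -> uniq s ->
  cycle (adj S) s -> False.
Proof.
move=> SB sl us cs; apply: noC; rewrite -sl; apply: cycle_contains_copy => //.
by case: s cs {sl us} => //= x s; apply: sub_path => a b; apply: (subsetP SB).
Qed.

(** Otherwise delete these red edges from [E]: the copy of the cycle that survives inside [U] is
    blue. *)
Lemma many_red kappa delta (U : {set 'I_n}) :
  robust (C_graph l) (kappa / (2 * l%:R)) delta ->
  (2 * l)%:R <= kappa * n%:R -> kappa * n%:R <= #|U|%:R ->
  delta * (n%:R ^+ 2 * p) < #|[set e in E :&: Red | e \subset U]|%:R.
Proof.
move=> rob nl nU; rewrite ltNge; apply/negP => Dle.
have [T [sT TU]] := exists_spread (leq_trans (isT : (0 < 5)%N) l5) nl nU.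
set D := [set e in _ | _] in Dle.
have DE : D \subset E by apply/subsetP => e; rewrite !inE => /andP[/andP[]].
have tr := rob T D sT DE Dle.
apply: noC; apply: (transv_copy sT).
case: tr => f [fT fS]; exists f; split=> //; apply/subsetP => d dC.
have := subsetP fS d dC; rewrite !inE => /andP[dD dE]; rewrite dE orbT andbT.
apply/negP => dR; move: dD; rewrite dE dR /= => /negP; apply.
by case/imsetP: dC => e _ ->; apply/subsetP => _ /imsetP[i _ ->]; apply: (subsetP (TU i)).
Qed.

Lemma red_of_not_blue x y : adj E x y -> ~~ adj Blue x y -> adj Red x y.
Proof. by rewrite /adj !inE => ->; rewrite orbT andbT negbK. Qed.

(** The blue edges inside [W] are few enough to be deleted, and the clique that survives is red. *)
Lemma red_clique_few_blue k kappa delta (W : {set 'I_n}) : (0 < k)%N ->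
  robust (K_graph k) (kappa / (2 * k%:R)) delta ->
  (2 * k)%:R <= kappa * n%:R -> kappa * n%:R <= #|W|%:R ->
  #|[set e in E :&: Blue | e \subset W]|%:R <= delta * (n%:R ^+ 2 * p) -> clique Red k W.
Proof.
move=> k0 rob nk nW Dle; have [T [sT TW]] := exists_spread k0 nk nW.
set D := [set e in _ | _] in Dle.
have DE : D \subset E by apply/subsetP => e; rewrite !inE => /andP[/andP[]].
have [|f [fi fT fS]] := transv_K _ (rob T D sT DE Dle).
  by apply: subset_trans (subsetDl _ _) EE.
exists f; split=> // [i|i j ij]; first exact: subsetP (TW i) _ (fT i).
have := fS i j ij; rewrite /adj inE => /andP[dD dE].
apply: red_of_not_blue => //; apply/negP => dB; move: dD; rewrite !inE -!andbA dE /=.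
move: dB; rewrite /adj !inE => /andP[-> _]; rewrite orbT /= subUset !sub1set.
by rewrite (subsetP (TW i) _ (fT i)) (subsetP (TW j) _ (fT j)).
Qed.

(** In units of [b], a bound for the room [(k + 1) (a + r b) + k a] asked for by [branches], given
    [a <= b] and [r + 1 = (l - 1) / 2]. *)
Definition bfs_size k : nat := (k.+1 * (l - 1)./2 + k)%N.

(* From one root grow [k] disjoint blue trees of depth [(l - 1) / 2] with linearly large last
   levels: a blue edge between two last levels closes a blue cycle of length [l]. *)
Lemma red_clique_many_blue k (kappa delta : R) (W : {set 'I_n}) :
  kappa * (32 * (bfs_size k)%:R) = delta -> 0 < delta -> (0 < k)%N ->
  1 <= kappa * (n%:R * p) -> 16 <= delta * n%:R ->
  (forall T : 'I_k -> {set 'I_n}, spread kappa T -> transv (K_graph k) T E) ->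
  (forall S T : {set 'I_n}, kappa * (n%:R * p) <= #|S|%:R -> #|T|%:R <= delta / 8 * n%:R ->
      (npairs (adj E) S T)%:R < delta * (n%:R * p) * #|S|%:R) ->
  delta * (n%:R ^+ 2 * p) < #|[set e in E :&: Blue | e \subset W]|%:R ->
  clique Red k W.
Proof.
move=> kapQ d0 k0 kap1 dn HK HP; set D := [set e in _ | _] => Dgt.
have DE : D \subset E by apply/subsetP => e; rewrite !inE => /andP[/andP[]].
have DB : D \subset Blue by apply/subsetP => e; rewrite inE => /andP[/setIP[]].
have DW e : e \in D -> e \subset W by rewrite inE => /andP[].
have se : symmetric (adj D) := @adj_sym _ D.
have Dir : irreflexive (adj D) by apply/adj_irr/(subset_trans DE EE).
move QE' : (bfs_size k) kapQ => Q kapQ.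
have [r r0 lr] : exists2 r, (0 < r)%N & l = (2 * r.+1).+1.
  exists ((l - 1)./2).-1; first by move: l5; clear; lia.
  have : odd (l - 1) = false by rewrite oddB ?lo //; apply: leq_trans l5.
  move: l5 (odd_double_half (l - 1)); clear => l5 h ho; move: h; rewrite ho -mul2n; lia.
have QE : Q = (k.+1 * r.+1 + k)%N.
  by rewrite -QE' /bfs_size lr subSS subn0 mul2n doubleK.
have Q0 : 0 < Q%:R :> R by rewrite ltr0n QE addn_gt0 muln_gt0.
have kQ : k%:R <= Q%:R :> R by rewrite ler_nat QE leq_addl.
have kapE : kappa * Q%:R = delta / 32 by rewrite -kapQ; field.
have kap0 : 0 < kappa by rewrite -(pmulr_lgt0 _ Q0) kapE divr_gt0.
have npn : n%:R * p <= n%:R by rewrite ler_piMr.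
have np0 : 0 <= n%:R * p by rewrite mulr_ge0 // ltW.
(* The blue edges in [W] contain a subgraph of minimum degree at least [delta n p], in which the
   trees grow. *)
have [A' [B' [AW BW A0 hA hB]]] : exists A' B' : {set 'I_n}, [/\ A' \subset W, B' \subset W, A' != set0,
    forall a, a \in A' -> delta * (n%:R * p) <= #|nbr (adj D) a B'|%:R
    & forall b, b \in B' -> delta * (n%:R * p) <= #|nbr (adj D) b A'|%:R].
  apply: exists_mindeg => //; first by rewrite mulr_ge0 // ltW.
  apply: (@le_lt_trans _ _ (2 * (delta * (n%:R ^+ 2 * p)))).
    have -> : 2 * (delta * (n%:R ^+ 2 * p)) = delta * (n%:R * p) * (n%:R + n%:R) by ring.
    apply: ler_wpM2l; first by rewrite mulr_ge0 // ltW.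
    have Wn : #|W|%:R <= n%:R :> R by rewrite ler_nat -[leqRHS]card_ord max_card.
    by rewrite natrD lerD.
  apply: (@lt_le_trans _ _ (2 * #|D|)%:R); first by rewrite natrM ltr_pM2l.
  rewrite ler_nat -handshake; last by move=> d /(subsetP DE)/(subsetP EE); rewrite inE.
  apply/subset_leq_card/subsetP => -[x y]; rewrite !inE /= => xy; rewrite xy andbT.
  by have := DW _ xy; rewrite subUset !sub1set.
pose X := A' :|: B'.
have XW : X \subset W by rewrite subUset AW.
have Xdeg x : x \in X -> delta * (n%:R * p) <= #|nbr (adj D) x X|%:R.
  rewrite inE => /orP[/hA|/hB] h; apply: (le_trans h); rewrite ler_nat;
  apply/subset_leq_card/subsetP => y; rewrite !inE => /andP[-> ->]; by rewrite ?orbT.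
pose a := (Num.truncn (kappa * (n%:R * p))).+1.
pose b := (Num.truncn (kappa * n%:R)).+1.
pose C := Num.truncn (delta / 8 * n%:R).
have kn0 : 0 <= kappa * n%:R by rewrite mulr_ge0 // ltW.
have dn0 : 0 <= delta / 8 * n%:R by rewrite mulr_ge0 // divr_ge0 // ltW.
have knp0 : 0 <= kappa * (n%:R * p) by rewrite mulr_ge0 // ltW.
have knn : kappa * (n%:R * p) <= kappa * n%:R by rewrite ler_wpM2l // ltW.
have /andP[a1 a2] := truncn_itv knp0.
have /andP[b1 b2] := truncn_itv kn0.
have ab : (a <= b)%N by rewrite ltnS; apply: le_truncn.
have aR : a%:R <= 2 * (kappa * (n%:R * p)).
  by rewrite /a -natr1; move: a1 kap1; lra.
have bR : b%:R <= 2 * (kappa * n%:R).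
  by rewrite /b -natr1; move: b1 knn kap1; lra.
have expand (S T : {set 'I_n}) : (a <= #|S|)%N -> (#|T| <= C)%N ->
  (npairs (adj D) S T)%:R < delta * (n%:R * p) * #|S|%:R.
  move=> aS TC; apply: le_lt_trans (HP S T _ _).
  - rewrite ler_nat; apply: npairs_mono => // x y; exact: (subsetP DE).
  - by apply: le_trans (ltW a2) _; rewrite ler_nat.
  - by rewrite -truncn_ge_nat.
have /set0Pn[u uA] := A0.
have uX : u \in X by rewrite inE uA.
have Mdeg : (k * a <= #|nbr (adj D) u X|)%N.
  rewrite -(ler_nat R) natrM; apply: le_trans (Xdeg u uX).
  have k0' : 0 <= k%:R :> R by rewrite ler0n.
  apply: (le_trans (ler_wpM2l k0' aR)).
  have := ler_wpM2l (ltW kap0) kQ; rewrite kapE => h.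
  have h2 := ler_wpM2r np0 h.
  have -> : k%:R * (2 * (kappa * (n%:R * p))) = 2 * (kappa * k%:R * (n%:R * p)) by ring.
  have := mulr_ge0 (ltW d0) np0; move: h2; move: (n%:R * p) => w; lra.
(* By [kapE] the trees take at most [delta n / 16] vertices; [16 <= delta n] makes room for the
   extra 1 within [delta n / 8]. *)
have szC : (k.+1 * (a + r * b) + k * a + 1 <= C)%N.
  apply: (@leq_trans (Q * b + 1)).
    rewrite leq_add2r QE mulnDl; apply: leq_add; last by rewrite leq_mul2l ab orbT.
    by rewrite -mulnA leq_mul2l mulSn leq_add2r ab orbT.
  rewrite truncn_ge_nat // natrD natrM.
  have := ler_wpM2l (ltW Q0) bR.
  have -> : Q%:R * (2 * (kappa * n%:R)) = 2 * (kappa * Q%:R * n%:R) by ring.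
  rewrite kapE; move: dn; move: (n%:R : R) => w; lra.
have [B [T [hBT hdis]]] := branches Xdeg expand ab uX (negbT (Dir u)) r0 Mdeg szC.
have sT : spread kappa (fun i : 'I_k => T i).
  split=> [i|i j ij]; first by have [_ _ ->] := hBT i (ltn_ord i); apply: ltW.
  have [[_ Ti _] _ _] := hBT i (ltn_ord i); have [[_ Tj _] _ _] := hBT j (ltn_ord j).
  by apply: disjointWl Ti _; apply: disjointWr Tj _; apply: hdis.
have [f [fi fT fS]] := transv_K EE (HK _ sT).
have fX i : f i \in X by have [_ TX _] := hBT i (ltn_ord i); apply: (subsetP TX).
have fW i : f i \in W by apply: (subsetP XW).
exists f; split=> // i j ij; apply: red_of_not_blue; first exact: fS.
apply/negP => bl.
have fD : adj D (f i) (f j).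
  rewrite /adj inE inE; apply/andP; split; last by rewrite subUset !sub1set !fW.
  by apply/andP; split; [exact: fS|exact: bl].
have [bi _ _] := hBT i (ltn_ord i); have [bj _ _] := hBT j (ltn_ord j).
have [s [ss us cs]] := branch_cycle se bi bj (hdis i j (ltn_ord i) (ltn_ord j) ij) (fT i) (fT j) fD.
by apply: (no_blue_cycle DB _ us cs); rewrite ss -lr.
Qed.

Lemma clique_red_of_hub k z (P Q : {set 'I_n}) :
  hub (adj Blue) (l%:R : R) z P Q -> clique E k (P :\ z) -> clique Red k (P :\ z).
Proof.
move=> hb cl; apply: (clique_sub cl) => x y; rewrite !inE => /andP[xz xP] /andP[yz yP] xy.
apply: red_of_not_blue => //; apply/negP => bl.
have [s [ss us cs]] := hub_cycle (@adj_sym _ Blue) (adj_irr Blue_graph) lo l5 hb xP yP xz yz bl.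
exact: (no_blue_cycle (subxx _) ss us cs).
Qed.

Lemma nbr_split w (S : {set 'I_n}) :
  (#|nbr (adj G) w S| <= #|nbr (adj Blue) w S| + #|nbr (adj (G :&: Red)) w S|)%N.
Proof.
apply: leq_trans (leq_card_setU _ _); apply/subset_leq_card/subsetP => y.
rewrite !inE /adj !inE => /andP[-> ->] /=; by case: (_ \in Red).
Qed.

(* [W] is joined to much of the graph in blue, which yields a blue hub inside the red
   neighbourhood of [v]; there G(n,p) has only red edges. *)
Lemma red_K_of_nbr (g ep : R) v (W : {set 'I_n}) : let c := ep * g / 4 in
  0 < g -> 0 < ep -> ep * n%:R <= #|W|%:R -> W \subset nbr (adj Red) v setT ->
  (forall w, w \in W -> g * n%:R <= #|nbr (adj G) w setT|%:R) ->
  (npairs (adj (G :&: Red)) setT setT)%:R <= ep * g / 2 * n%:R ^+ 2 ->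
  l%:R <= c ^+ 2 / 4 * n%:R ->
  (forall W' : {set 'I_n}, c ^+ 2 / 8 * n%:R <= #|W'|%:R -> clique E t.-1 W') ->
  contains_copy (K_graph t) Red.
Proof.
move=> c g0 e0 Wn Wv Wdeg few ln HK.
have c0 : 0 < c by rewrite divr_gt0 ?mulr_gt0.
have l0 : 5 <= l%:R :> R by rewrite (ler_nat _ 5).
have n0 : 0 < n%:R :> R.
  rewrite lt_neqAle ler0n andbT; apply/negP => /eqP n0; move: ln l0; rewrite -n0 mulr0; lra.
(* [W] sends at least [4 c n^2] pairs in [G], of which at most [2 c n^2] are red. *)
have many : c * #|'I_n|%:R ^+ 2 < (npairs (adj Blue) W setT)%:R.
  rewrite card_ord; have h1 : ep * g * n%:R ^+ 2 <= (npairs (adj G) W setT)%:R.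
    rewrite npairs_sum natr_sum; apply: (@le_trans _ _ (\sum_(w in W) g * n%:R)).
      rewrite sumr_const -[leRHS]mulr_natr; have gn : 0 <= g * n%:R by rewrite mulr_ge0 // ltW.
      have := ler_wpM2l gn Wn; rewrite (_ : _ * (ep * n%:R) = ep * g * n%:R ^+ 2) //; ring.
    by apply: ler_sum => w wW; apply: Wdeg.
  have h2 : (npairs (adj G) W setT <= npairs (adj Blue) W setT + npairs (adj (G :&: Red)) setT setT)%N.
    apply: (@leq_trans (npairs (adj Blue) W setT + npairs (adj (G :&: Red)) W setT)).
      by rewrite !npairs_sum -big_split /=; apply: leq_sum => w _; apply: nbr_split.
    by rewrite leq_add2l; apply: npairs_mono => //; apply: subsetT.
  rewrite -(ler_nat R) natrD in h2.
  have h3 : 0 < c * n%:R ^+ 2 by rewrite mulr_gt0 ?exprn_gt0.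
  have cE : ep * g = 4 * c by rewrite /c; field.
  move: h1 few h2 h3; rewrite cE; move: (n%:R ^+ 2) => w; lra.
have [z [P [Q [PW P0 hb]]]] := exists_hub (@adj_sym _ Blue) c0 many.
rewrite card_ord in hb; have [QN hP hQ] := hb.
have hbl : hub (adj Blue) (l%:R : R) z P Q.
  by split=> // [a /hP|b /hQ]; apply: le_trans.
have Pbig : c ^+ 2 / 8 * n%:R <= #|P :\ z|%:R.
  have -> : c ^+ 2 / 8 * n%:R = c ^+ 2 / 4 * n%:R / 2 by field.
  by apply: (hub_card P0 _ hb); apply: le_trans ln; lra.
have clR := clique_red_of_hub hbl (HK _ Pbig).
have tE : t = t.-1.+1 by case: t t4.
rewrite tE; apply: clique_copy; apply: (clique_extend (v := v) Red_graph clR).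
move=> w; rewrite inE => /andP[_ /(subsetP PW)/(subsetP Wv)].
by rewrite inE => /andP[].
Qed.

Lemma red_K_few_red (g : R) z (P Q : {set 'I_n}) : let c := g ^+ 2 / 16 in
  0 < g -> hub (adj G) (g * n%:R) z P Q -> clique E t (P :\ z) ->
  (npairs (adj (G :&: Red)) setT setT)%:R <= g ^+ 2 / 8 * n%:R ^+ 2 ->
  l%:R <= c ^+ 2 / 4 * n%:R -> l%:R <= g / 2 * n%:R ->
  (forall W' : {set 'I_n}, c ^+ 2 / 8 * n%:R <= #|W'|%:R -> clique E t.-1 W') ->
  contains_copy (K_graph t) Red.
Proof.
move=> c g0 hb clE few ln1 ln2 HK; have [QN hP hQ] := hb.
have degG w : w \in P :|: Q -> g * n%:R <= #|nbr (adj G) w setT|%:R.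
  rewrite inE => /orP[/hP|/hQ] h; apply: (le_trans h); rewrite ler_nat;
  by apply/subset_leq_card/subsetP => y; rewrite !inE => /andP[_ ->].
have cE : c = g / 4 * g / 4 by rewrite /c; field.
(* The first alternative is [red_K_of_nbr] with [ep = g / 4], whence [c = g^2 / 16]. *)
have [[v [S SPQ hS]]|no] := pselect (exists v, exists2 S : {set 'I_n}, S \subset P :|: Q
     & g / 4 * n%:R <= #|nbr (adj (G :&: Red)) v S|%:R).
  apply: (@red_K_of_nbr g (g / 4) v _ g0 _ hS); rewrite -?cE //.
  - by rewrite divr_gt0.
  - by apply/subsetP => w; rewrite !inE /adj inE => /andP[_ /andP[]].
  - by move=> w; rewrite inE => /andP[/(subsetP SPQ) wS _]; apply: degG.
  - by apply: (le_trans few); rewrite le_eqVlt; apply/orP; left; apply/eqP; field.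
have small v (S : {set 'I_n}) : S \subset P :|: Q -> #|nbr (adj (G :&: Red)) v S|%:R <= g / 4 * n%:R.
  move=> SPQ; apply: ltW; rewrite ltNge; apply/negP => h; apply: no; by exists v, S.
(* After restriction to the blue neighbours of [z], a vertex of [P] loses at most [g n / 4]
   neighbours to its own red edges and as many to those of [z]; at least [g n / 2] remain. *)
pose Qb := nbr (adj Blue) z Q.
have hbl : hub (adj Blue) (l%:R : R) z P Qb.
  split.
  - by apply/subsetP => y; rewrite !inE => /andP[_ ->].
  - move=> a aP; apply: (le_trans ln2).
    have h1 : (#|nbr (adj G) a Q| <= #|nbr (adj Blue) a Qb| + #|nbr (adj (G :&: Red)) a Q|
         + #|nbr (adj (G :&: Red)) z Q|)%N.
      rewrite -addnA addnC -addnA; apply: (@leq_trans #|nbr (adj (G :&: Red)) a Q :|: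
          (nbr (adj (G :&: Red)) z Q :|: nbr (adj Blue) a Qb)|); last first.
        apply: leq_trans (leq_card_setU _ _) _; rewrite leq_add2l; exact: leq_card_setU.
      apply/subset_leq_card/subsetP => y; rewrite !inE => /andP[yQ ay].
      have zy : adj G z y by have := subsetP QN y yQ; rewrite inE => /andP[].
      move: ay zy; rewrite yQ /adj !inE /= => -> -> /=.
      by case: ([set a; y] \in Red); case: ([set z; y] \in Red).
    have s1 := small a Q (subsetUr _ _); have s2 := small z Q (subsetUr _ _).
    have := hP a aP; move: h1; rewrite -(ler_nat R) !natrD.
    move: (n%:R : R) s1 s2 => w; lra.
  - move=> b; rewrite inE => /andP[bQ _]; apply: (le_trans ln2).
    have s1 := small b P (subsetUl _ _); have := nbr_split b P; rewrite -(ler_nat R) natrD.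
    have := hQ b bQ; have := mulr_ge0 (ltW g0) (ler0n R n); move: (n%:R : R) s1 => w; lra.
exact: clique_copy (clique_red_of_hub hbl clE).
Qed.

(* Averaging over the red neighbourhoods [U b], each rich in red edges of G(n,p), gives one
   such edge with linearly many common red neighbours. *)
Lemma red_K_many_red (ep delta : R) : 0 < ep -> 0 < delta -> (0 < n)%N ->
  ep * n%:R ^+ 2 < (npairs (adj (G :&: Red)) setT setT)%:R ->
  robust (C_graph l) (ep / 2 / (2 * l%:R)) delta -> (2 * l)%:R <= ep / 2 * n%:R ->
  #|E|%:R <= 4 * (n%:R ^+ 2 * p) ->
  (forall W : {set 'I_n}, ep * delta / 8 * n%:R <= #|W|%:R -> clique Red t.-2 W) ->
  contains_copy (K_graph t) Red.
Proof.
move=> e0 d0 n0 many rob nl En HW.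
have n0' : 0 < n%:R :> R by rewrite ltr0n.
pose U b := nbr (adj (G :&: Red)) b setT.
pose Bs := [set b | ep / 2 * n%:R <= #|U b|%:R].
pose RE := E :&: Red.
pose w (d : {set 'I_n}) := [set b | d \subset U b].
(* Vertices outside [Bs] account for at most half of the [ep n^2] red pairs, so [Bs] carries the
   rest, at most [n] pairs per vertex. *)
have Bsn : ep / 2 * n%:R < #|Bs|%:R.
  have : (npairs (adj (G :&: Red)) setT setT)%:R <= #|Bs|%:R * n%:R + n%:R * (ep / 2 * n%:R) :> R.
    rewrite npairs_sum natr_sum.
    rewrite (eq_bigl xpredT) => [|b]; last by rewrite inE.
    rewrite (bigID (mem Bs)) /=; apply: lerD.
      apply: (@le_trans _ _ (\sum_(b in Bs) n%:R)); last by rewrite sumr_const -[leLHS]mulr_natl.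
      by apply: ler_sum => b _; rewrite ler_nat -[leqRHS]card_ord max_card.
    apply: (@le_trans _ _ (\sum_(b : 'I_n) ep / 2 * n%:R)); last first.
      by rewrite sumr_const card_ord -[leLHS]mulr_natl.
    rewrite big_mkcond; apply: ler_sum => b _; case: ifP => [|_]; last by rewrite mulr_ge0 ?divr_ge0 // ltW.
    by rewrite inE -ltNge => /ltW.
  move: many => many le2; rewrite -(ltr_pM2r n0').
  have := lt_le_trans many le2.
  rewrite (_ : ep * n%:R ^+ 2 = 2 * (ep / 2 * n%:R * n%:R)); last by field.
  rewrite (_ : n%:R * (ep / 2 * n%:R) = ep / 2 * n%:R * n%:R); last by ring.
  by move: (ep / 2 * n%:R * n%:R) (#|Bs|%:R * n%:R) => x y; lra.
(* Each of more than [ep n / 2] sets [U b] contains over [delta n^2 p] edges of [RE], and [RE] has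
   at most [4 n^2 p] edges: on average an edge lies in at least [ep delta n / 8] of the sets. *)
have [d dRE dw] : exists2 d, d \in RE & ep * delta / 8 * n%:R <= #|w d|%:R.
  apply: contrapT => no.
  have ub : \sum_(b in Bs) #|[set d in RE | d \subset U b]|%:R <= #|RE|%:R * (ep * delta / 8 * n%:R) :> R.
    apply: (@le_trans _ _ (\sum_(d in RE) #|w d|%:R)); last first.
      rewrite mulr_natl -sumr_const; apply: ler_sum => d dRE.
      by apply: ltW; rewrite ltNge; apply/negP => h; apply: no; exists d.
    apply: (@le_trans _ _ (\sum_(b in Bs) \sum_(d in RE) (d \subset U b)%:R)).
      apply: ler_sum => b _; rewrite -sum1_card natr_sum big_mkcond [leRHS]big_mkcond /=.
      by apply: ler_sum => d _; rewrite !inE; case: ifP => [/andP[-> ->]|_] //; case: ifP.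
    rewrite exchange_big; apply: ler_sum => d _; rewrite -sum1_card natr_sum.
    rewrite big_mkcond [leRHS]big_mkcond /=; apply: ler_sum => b _; rewrite [b \in w d]inE.
    by case: ifP => _; case: ifP.
  have lb : #|Bs|%:R * (delta * (n%:R ^+ 2 * p)) <= \sum_(b in Bs) #|[set d in RE | d \subset U b]|%:R :> R.
    rewrite mulr_natl -sumr_const; apply: ler_sum => b; rewrite inE => hb.
    exact: ltW (many_red rob nl hb).
  have REn : #|RE|%:R <= 4 * (n%:R ^+ 2 * p).
    by apply: le_trans En; rewrite ler_nat; apply/subset_leq_card/subsetIl.
  have m0 : 0 < n%:R ^+ 2 * p by rewrite mulr_gt0 ?exprn_gt0.
  have x0 : 0 <= ep * delta / 8 * n%:R by rewrite mulr_ge0 ?divr_ge0 ?mulr_ge0 // ltW.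
  have y0 : 0 < delta * (n%:R ^+ 2 * p) by rewrite mulr_gt0.
  have h1 := ler_wpM2r x0 REn.
  have h2 : ep / 2 * n%:R * (delta * (n%:R ^+ 2 * p)) < #|Bs|%:R * (delta * (n%:R ^+ 2 * p)).
    by rewrite ltr_pM2r.
  have := lt_le_trans h2 (le_trans lb (le_trans ub h1)).
  rewrite (_ : 4 * (n%:R ^+ 2 * p) * (ep * delta / 8 * n%:R) = ep / 2 * n%:R * (delta * (n%:R ^+ 2 * p))).
    by rewrite ltxx.
  by field.
have clW := HW _ dw.
have [dE dR] : d \in E /\ d \in Red by apply/andP; rewrite inE in dRE.
have /cards2P[x [y [xy dxy]]] : #|d| == 2%N by have := subsetP EE d dE; rewrite inE.
have wU b : b \in w d -> adj Red x b /\ adj Red y b.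
  rewrite inE dxy subUset !sub1set !inE /adj !inE => /andP[/andP[_ /andP[_ hx]] /andP[_ /andP[_ hy]]].
  by rewrite ![[set _; b]]setUC hx hy.
have cl1 : clique Red t.-2.+1 (y |: w d).
  by apply: (clique_extend Red_graph clW) => b /wU[].
have cl2 : clique Red t.-2.+2 (x |: (y |: w d)).
  apply: (clique_extend Red_graph cl1) => b; rewrite inE => /orP[|/wU[]//].
  by rewrite inE => /eqP ->; rewrite /adj -dxy.
have tE : t = t.-2.+2 by case: t t4 => [|[]].
by rewrite tE; apply: clique_copy cl2.
Qed.

End Colouring.

(** * Dense graphs above the threshold *)

Section Assembly.
Variables (R : realType) (t l : nat).
Hypotheses (t4 : (4 <= t)%N) (lo : odd l) (l5 : (5 <= l)%N).

(** The sum of absolute values stands in for a maximum: the single assumption [S <= scale n p] then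
    implies every lower bound collected in the list. *)
Lemma le_sum_norm (s : seq R) x : x \in s -> x <= \sum_(y <- s) `|y|.
Proof.
move=> xs; rewrite (big_rem x) //=; apply: (le_trans (ler_norm x)).
by rewrite lerDl sumr_ge0.
Qed.

Lemma Gnp_probE n (p : R) (A : {set {set 'I_n}} -> Prop) : Gnp_prob p A = Pr p (edges_of n) A.
Proof.
rewrite /Gnp_prob /Pr /Ex big_mkcondr; apply: eq_bigr => E _.
by case: asboolP; rewrite ?mulr1 ?mulr0.
Qed.

Definition scale n (p : R) : R := Num.sqrt (n%:R ^+ 2 * p ^+ t.-1).

Lemma scaleP n (p S : R) : 0 <= p -> p <= 1 -> 1 <= S -> S <= scale n p ->
  [/\ 0 < p, (0 < n)%N, 1 <= n%:R ^+ 2 * p ^+ t.-1, S <= n%:R & S <= n%:R * p] /\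
  (S <= n%:R ^+ 2 * p) /\ ((5 <= t)%N -> S <= n%:R * p ^+ 2).
Proof.
move=> p0 p1 S1 SL; set L := n%:R ^+ 2 * p ^+ t.-1 in SL *.
have S0 : 0 <= S by apply: le_trans S1.
have L0 : 0 <= L by rewrite mulr_ge0 ?exprn_ge0.
have SSL : S ^+ 2 <= L by rewrite -(sqr_sqrtr L0) ler_sqr ?nnegrE ?sqrtr_ge0.
have L1 : 1 <= L by apply: le_trans SSL; rewrite -[1](expr1n _ 2) ler_sqr ?nnegrE.
have pp : 0 < p.
  rewrite lt_neqAle p0 andbT; apply: contraTneq L1 => pz.
  by rewrite /L -pz expr0n mulr_natr; case: t t4 => [|[]] // t'; rewrite /= mulr0n -ltNge.
have nn : (0 < n)%N.
  rewrite lt0n; apply: contraTneq L1 => n0.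
  by rewrite /L n0 expr0n /= mul0r -ltNge.
have np : S <= n%:R * p.
  apply: ler_of_sqr; first by rewrite mulr_ge0.
  exact: le_trans SSL (np_sqr_ge n t4 pp p1).
have n1 : 1 <= n%:R :> R by rewrite ler1n.
have nS : S <= n%:R by apply: (le_trans np); rewrite ler_piMr.
split=> //; split=> [|t5].
  by apply: (le_trans np); rewrite expr2 -mulrA ler_peMl // mulr_ge0.
(* [(n p^2)^2 = n^2 p^4] is at least [n^2 p^(t-1)] exactly because [4 <= t - 1]. *)
apply: ler_of_sqr; first by rewrite mulr_ge0 ?exprn_ge0.
apply: (le_trans SSL); rewrite exprMn -exprM; apply: le_scale => //.
by move: t5; clear; lia.
Qed.

Lemma le_lin (kappa X S N : R) : 0 < kappa -> X / kappa <= S -> S <= N -> X <= kappa * N.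
Proof. by move=> k0 XS SN; rewrite -ler_pdivrMl // mulrC; apply: le_trans SN. Qed.

Definition red_cliques n (G E : {set {set 'I_n}}) (kappa : R) : Prop :=
  forall Red : {set {set 'I_n}}, Red \subset G :|: E -> ~ contains_copy (C_graph l) (Blue G E Red) ->
  forall W : {set 'I_n}, kappa * n%:R <= #|W|%:R -> clique Red t.-2 W.

Let l0 : (0 < l)%N. Proof. exact: leq_trans l5. Qed.
Let CE : is_graph (C_graph l). Proof. by apply: C_graph_is_graph; apply: leq_trans l5. Qed.
Let C0 : C_graph l != set0. Proof. exact: C_graph_neq0. Qed.

Lemma part_range (kappa : R) k : 0 < kappa -> kappa <= 1 -> (0 < k)%N -> 0 < kappa / (2 * k%:R) <= 1.
Proof.
move=> k0 k1 kk; have kR : 1 <= k%:R :> R by rewrite ler1n.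
have h : 0 < 2 * k%:R :> R by rewrite mulr_gt0 // ltr0n.
by rewrite divr_gt0 //= ler_pdivrMr // mul1r; lra.
Qed.

Lemma red_cliques_whp (kappa eps : R) : 0 < kappa -> kappa <= 1 -> 0 < eps ->
  exists2 S : R, 1 <= S & forall n (p : R) (G : {set {set 'I_n}}), 0 <= p -> p <= 1 -> is_graph G ->
    S <= scale n p -> Pr p (edges_of n) (fun E => ~ red_cliques G E kappa) <= eps.
Proof.
move=> k0 k1 e0; have [t5|t45] := leqP 5 t; last first.
  have tE : t = 4%N by apply/eqP; rewrite eqn_leq -ltnS t45.
  have /andP[a0 a1] := part_range k0 k1 l0.
  have [delta /andP[d0 _] hd] := transv_robust CE C0 a0 a1.
  have [M M0 hM] := hd eps e0.
  pose s := [:: 1; M; (2 * l)%:R / kappa].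
  pose S := \sum_(y <- s) `|y|.
  have inS x : x \in s -> x <= S := @le_sum_norm s x.
  exists S => [|n p G p0 p1 GE SL]; first by apply: inS; rewrite !inE eqxx.
  have S1 : 1 <= S by apply: inS; rewrite !inE eqxx.
  have [[pp nn L1 nS npS] _] := scaleP p0 p1 S1 SL.
  have MnP : M <= n%:R * p by apply: le_trans npS; apply: inS; rewrite !inE eqxx orbT.
  apply: le_trans (hM n p pp p1 MnP (balanced_C t4 pp p1 L1 l5)).
  apply: Pr_le => // E EU hE rob; apply: hE => Red RS noC W nW; rewrite tE /=.
  have ln : (2 * l)%:R <= kappa * n%:R.
    by apply: (le_lin k0 _ nS); apply: inS; rewrite !inE eqxx !orbT.
  have := many_red l5 noC rob ln nW => many.
  have /card_gt0P[e] : (0 < #|[set e in E :&: Red | e \subset W]|)%N.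
    rewrite -(ltr0n R); apply: le_lt_trans many.
    by rewrite mulr_ge0 ?(ltW d0) // mulr_ge0 ?exprn_ge0.
  rewrite inE => /andP[/setIP[eE eR] eW].
  have /cards2P[x [y [xy exy]]] : #|e| == 2%N by have := subsetP EU e eE; rewrite inE.
  move: eW; rewrite exy subUset !sub1set => /andP[xW yW].
  have exy' : adj Red x y by rewrite /adj -exy.
  exists (fun i : 'I_2 => if (i : nat) == 0%N then x else y); split.
  - move=> [[|[|i]] hi] [[|[|j]] hj] //= h; try exact: val_inj.
      by rewrite h eqxx in xy.
    by rewrite h eqxx in xy.
  - by move=> i; case: ifP.
  - by move=> [[|[|i]] hi] [[|[|j]] hj] //= _; rewrite adj_sym.
have k2 : (0 < t.-2)%N by move: t4; clear; lia.
have KE : is_graph (K_graph t.-2) := @K_graph_is_graph _.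
have K0 : K_graph t.-2 != set0 by apply: K_graph_neq0; move: t4; clear; lia.
have /andP[a0 a1] := part_range k0 k1 k2.
have [delta /andP[d0 d1] hd] := transv_robust KE K0 a0 a1.
pose Q : R := (bfs_size l t.-2)%:R.
have Q1 : 1 <= Q by rewrite ler1n addn_gt0 k2 orbT.
have Q0 : 0 < 32 * Q by rewrite mulr_gt0 //; apply: lt_le_trans Q1.
(* The value demanded by [red_clique_many_blue]. Last levels have at least [kap * n] vertices, so
   [transv_robust] is applied again for classes of that size. *)
pose kap := delta / (32 * Q).
have kap0 : 0 < kap by rewrite divr_gt0.
have kap1 : kap <= 1 by rewrite ler_pdivrMr // mul1r; lra.
have kapE : kap * (32 * Q) = delta by rewrite /kap mulfVK // gt_eqF.
have [delta' /andP[d0' _] hd'] := transv_robust KE K0 kap0 kap1.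
have e3 : 0 < eps / 3 by rewrite divr_gt0.
have [M M0 hM] := hd _ e3; have [M' M0' hM'] := hd' _ e3.
have [N N0 hN] := npairs_whp d0 kap0 e3.
pose s := [:: 1; M; M'; N; (2 * t.-2)%:R / kappa; 1 / kap; 16 / delta].
pose S := \sum_(y <- s) `|y|.
have inS x : x \in s -> x <= S := @le_sum_norm s x.
exists S => [|n p G p0 p1 GE SL]; first by apply: inS; rewrite !inE eqxx.
have S1 : 1 <= S by apply: inS; rewrite !inE eqxx.
have [[pp nn L1 nS npS] [_ npp]] := scaleP p0 p1 S1 SL.
have bal := balanced_K_pred2 pp p1 L1.
have h1 := hM n p pp p1 (le_trans (inS M _) npS) bal.
have h2 := hM' n p pp p1 (le_trans (inS M' _) npS) bal.
have h3 := hN n p pp p1 (le_trans (inS N _) (npp t5)).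
set A1 := (X in Pr _ _ X <= _) in h1; set A2 := (X in Pr _ _ X <= _) in h2.
set A3 := (X in Pr _ _ X <= _) in h3.
apply: (@le_trans _ _ (Pr p (edges_of n) (fun E => A1 E \/ (A2 E \/ A3 E)))); last first.
  apply: le_trans (Pr_or p0 p1 _ _ _) _.
  have := Pr_or p0 p1 (edges_of n) A2 A3.
  have := h1 _; have := h2 _; have := h3 _; rewrite !inE !eqxx !orbT.
  by move=> /(_ isT) x3 /(_ isT) x2 /(_ isT) x1; lra.
apply: Pr_le => // E EU hE; apply: contrapT => no.
have [nA1 [nA2 nA3]] : ~ A1 E /\ ~ A2 E /\ ~ A3 E.
  by split; [|split] => h; apply: no; [left|right; left|right; right].
have {}nA1 := contrapT nA1; have {}nA2 := contrapT nA2; have {}nA3 := contrapT nA3.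
apply: hE => Red RS noC W nW.
have tn : (2 * t.-2)%:R <= kappa * n%:R.
  by apply: (le_lin k0 _ nS); apply: inS; rewrite !inE eqxx !orbT.
have [few|many] := lerP #|[set e in E :&: Blue G E Red | e \subset W]|%:R (delta * (n%:R ^+ 2 * p)).
  exact: (red_clique_few_blue EU k2 nA1 tn nW few).
apply: (red_clique_many_blue EU lo l5 pp p1 noC kapE d0 k2 _ _ _ nA3 many).
- by apply: (le_lin kap0 _ npS); apply: inS; rewrite !inE eqxx !orbT.
- by apply: (le_lin d0 _ nS); apply: inS; rewrite !inE eqxx !orbT.
- move=> T sT; rewrite -[E]setD0; apply: nA2; rewrite ?sub0set ?cards0 //.
  by rewrite mulr_ge0 ?(ltW d0') // mulr_ge0 ?exprn_ge0.
Qed.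

Lemma dense_npairs n (G : {set {set 'I_n}}) (d : R) : 0 < d -> (2 <= n)%N ->
  is_graph G -> density_at_least G d -> d / 4 * n%:R ^+ 2 < (npairs (adj G) setT setT)%:R.
Proof.
move=> d0 n2 GE dG; rewrite handshake; last by move=> e /(subsetP GE); rewrite inE.
have h : d * (n%:R * n.-1%:R) <= 2 * #|G|%:R.
  rewrite -natrM -mul2_bin2 natrM mulrCA; apply: ler_wpM2l => //.
have n1 : n%:R / 2 <= n.-1%:R :> R.
  rewrite ler_pdivrMr // -natrM ler_nat; move: n2; clear; lia.
have n0 : 0 < n%:R :> R by rewrite ltr0n ltnW.
rewrite natrM; apply: lt_le_trans h.
have dn : 0 <= d * n%:R by rewrite mulr_ge0 // ltW.
have := ler_wpM2l dn n1; have : 0 < d * n%:R ^+ 2 by rewrite mulr_gt0 // exprn_gt0.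
rewrite (_ : d * n%:R * (n%:R / 2) = d * n%:R ^+ 2 / 2); last by field.
rewrite (_ : d / 4 * n%:R ^+ 2 = d * n%:R ^+ 2 / 4); last by field.
rewrite -mulrA; lra.
Qed.

Lemma ramsey_whp (d eps : R) : 0 < d -> d <= 2^-1 -> 0 < eps ->
  exists2 S : R, 1 <= S & forall n (p : R) (G : {set {set 'I_n}}), 0 <= p -> p <= 1 -> is_graph G ->
    density_at_least G d -> S <= scale n p ->
    Pr p (edges_of n) (fun E => ~ is_Ramsey (K_graph t) (C_graph l) (G :|: E)) <= eps.
Proof.
move=> d0 d1 e0.
have sq01 (x : R) : 0 < x -> x <= 1 -> 0 < x ^+ 2 <= 1.
  by move=> x0 x1; rewrite exprn_gt0 // exprn_ile1 // ltW.
(* The hub degree that [exists_hub] draws from the [d / 4 * n^2] pairs of [dense_npairs]. *)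
pose g := (d / 4) ^+ 2 / 4.
have /andP[g0 g1] : 0 < g <= 1.
  have /andP[a b] := sq01 (d / 4) (divr_gt0 d0 (ltr0n R 4)) ltac:(lra).
  by rewrite /g divr_gt0 //=; lra.
have /andP[gg0 gg1] := sq01 g g0 g1.
pose c := g ^+ 2 / 16.
have c0 : 0 < c by rewrite divr_gt0.
have /andP[cc0 cc1] := sq01 c c0 ltac:(rewrite /c; lra).
(* [k1] is the size of [P :\ z] from [hub_card], [k2] the clique size bound of [red_K_few_red], and
   [ep] the proportion of red pairs separating the two cases. *)
pose k1 := g / 2; pose k2 := c ^+ 2 / 8; pose ep := g ^+ 2 / 8.
have k10 : 0 < k1 by rewrite divr_gt0.
have k20 : 0 < k2 by rewrite divr_gt0.
have ep0 : 0 < ep by rewrite divr_gt0.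
have k11 : k1 <= 1 by rewrite /k1; lra.
have k21 : k2 <= 1 by rewrite /k2; lra.
have ep1 : ep <= 1 by rewrite /ep; lra.
have t0 : (0 < t)%N by move: t4; clear; lia.
have t1 : (0 < t.-1)%N by move: t4; clear; lia.
have e5 : 0 < eps / 5 by rewrite divr_gt0.
have /andP[a10 a11] := part_range k10 k11 t0.
have /andP[a20 a21] := part_range k20 k21 t1.
have ep20 : 0 < ep / 2 by rewrite divr_gt0.
have /andP[a30 a31] := part_range ep20 ltac:(lra) l0.
have KE k : is_graph (K_graph k) := @K_graph_is_graph k.
have Kt0 : K_graph t != set0 by apply: K_graph_neq0; move: t4; clear; lia.
have Kt1 : K_graph t.-1 != set0 by apply: K_graph_neq0; move: t4; clear; lia.
have [M1 M10 hM1] := transv_fixed (KE t) Kt0 a10 a11 e5.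
have [M2 M20 hM2] := transv_all (KE t.-1) Kt1 a20 a21 e5.
have [del /andP[del0 del1] hdel] := transv_robust CE C0 a30 a31.
have [M3 M30 hM3] := hdel _ e5.
have [M4 M40 hM4] := card_edges_whp e5.
pose kW := ep * del / 8.
have kW0 : 0 < kW by rewrite divr_gt0 ?mulr_gt0.
have kW1 : kW <= 1.
  have : ep * del <= 1 by rewrite -[1]mulr1 ler_pM // ltW.
  by rewrite /kW; lra.
have [S5 S51 hS5] := red_cliques_whp kW0 kW1 e5.
pose s := [:: 1; M1; M2; M3; M4; S5; 2; 2 / g; (2 * t)%:R / k1; (2 * t.-1)%:R / k2;
  l%:R / (c ^+ 2 / 4); l%:R / (g / 2); (2 * l)%:R / (ep / 2)].
pose S := \sum_(y <- s) `|y|.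
have inS x : x \in s -> x <= S := @le_sum_norm s x.
have all_inS : all (fun x => x <= S) s by apply/allP.
move: all_inS => /= /and5P[S1 SM1 SM2 SM3 /and5P[SM4 SS5 S2 Sg /and5P[Skt Skt1 Slc Slg /andP[Sll _]]]].
clearbody S; clear inS.
exists S => // n p G p0 p1 GE dG SL.
have [[pp nn L1 nS npS] [n2pS _]] := scaleP p0 p1 S1 SL.
have n2 : (2 <= n)%N by rewrite -(ler_nat R); apply: le_trans nS.
have gn2 : 2 <= g * n%:R by apply: (le_lin g0 Sg nS).
have ktn := le_lin k10 Skt nS.
have kt1n := le_lin k20 Skt1 nS.
have lcn := le_lin (divr_gt0 cc0 (ltr0n R 4)) Slc nS.
have lgn := le_lin k10 Slg nS.
have lln := le_lin ep20 Sll nS.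
have many := dense_npairs d0 n2 GE dG.
have d40 : 0 < d / 4 by rewrite divr_gt0.
(* The hub lives in [G], before [E] is drawn, so the classes [T] inside [P :\ z] are fixed and
   [transv_fixed] applies. *)
have [|z [P [Q [_ P0 hb]]]] := @exists_hub R _ (adj G) setT (d / 4) (@adj_sym _ G) d40.
  by rewrite card_ord.
rewrite card_ord -/g in hb.
have Pz := hub_card P0 gn2 hb; rewrite mulrAC -/k1 in Pz.
have [T [sT TP]] := exists_spread t0 ktn Pz.
have h1 := hM1 n p _ T pp p1 (le_trans SM1 SL) (balanced_K_t pp p1 L1) sT.
have h2 := hM2 n p _ nn pp p1 _ (balanced_K_pred pp p1 L1).
have {}h2 := h2 ltac:(rewrite mulrC ler_wpM2l //; exact: le_trans SM2 SL).
have h3 := hM3 n p pp p1 (le_trans SM3 npS) (balanced_C t4 pp p1 L1 l5).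
have h4 := hM4 n p pp p1 (le_trans SM4 n2pS).
have h5 := hS5 n p G p0 p1 GE (le_trans SS5 SL).
set A1 := (X in Pr _ _ X <= _) in h1; set A2 := (X in Pr _ _ X <= _) in h2.
set A3 := (X in Pr _ _ X <= _) in h3; set A4 := (X in Pr _ _ X <= _) in h4.
set A5 := (X in Pr _ _ X <= _) in h5.
apply: (@le_trans _ _ (Pr p (edges_of n) (fun E => A1 E \/ (A2 E \/ (A3 E \/ (A4 E \/ A5 E)))))); last first.
  have q1 := Pr_or p0 p1 (edges_of n) A1 (fun E => A2 E \/ (A3 E \/ (A4 E \/ A5 E))).
  have q2 := Pr_or p0 p1 (edges_of n) A2 (fun E => A3 E \/ (A4 E \/ A5 E)).
  have q3 := Pr_or p0 p1 (edges_of n) A3 (fun E => A4 E \/ A5 E).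
  have q4 := Pr_or p0 p1 (edges_of n) A4 A5.
  lra.
apply: Pr_le => // E EU hE; apply: contrapT => no.
have nA1 : transv (K_graph t) T E by apply: contrapT => h; apply: no; left.
have nA2 : forall T : 'I_t.-1 -> {set 'I_n}, spread (k2 / (2 * t.-1%:R)) T -> transv (K_graph t.-1) T E.
  by apply: contrapT => h; apply: no; right; left.
have nA3 : robust p E (C_graph l) (ep / 2 / (2 * l%:R)) del.
  by apply: contrapT => h; apply: no; right; right; left.
have nA4 : #|E|%:R <= 4 * (n%:R ^+ 2 * p).
  by apply: contrapT => h; apply: no; right; right; right; left.
have nA5 : red_cliques G E kW.
  by apply: contrapT => h; apply: no; right; right; right; right.
apply: hE => Red RS; have [hC|noC] := pselect (contains_copy (C_graph l) (Blue G E Red)); first by right.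
left; have clE : clique E t (P :\ z).
  have [f [fi fT fS]] := transv_K EU nA1.
  by exists f; split=> // i; apply: (subsetP (TP i)).
have HK (W' : {set 'I_n}) : k2 * n%:R <= #|W'|%:R -> clique E t.-1 W'.
  move=> nW; have [T' [sT' TW']] := exists_spread t1 kt1n nW.
  have [f [fi fT fS]] := transv_K EU (nA2 T' sT').
  by exists f; split=> // i; apply: (subsetP (TW' i)).
have [few|manyr] := lerP (npairs (adj (G :&: Red)) setT setT)%:R (ep * n%:R ^+ 2).
  exact: (red_K_few_red GE EU RS t4 lo l5 noC g0 hb clE few lcn lgn HK).
exact: (red_K_many_red GE EU RS t4 l5 pp noC ep0 del0 nn manyr nA3 lln nA4 (nA5 Red RS noC)).
Qed.

End Assembly.

(** * A bipartite graph below the threshold *)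

Section LowerBound.
Variable R : realType.

Definition bipartite_half n : {set {set 'I_n}} :=
  [set [set xy.1; xy.2] | xy in setX [set i : 'I_n | (i < n./2)%N] (~: [set i : 'I_n | (i < n./2)%N])].

Lemma bipartite_half_graph n : is_graph (bipartite_half n).
Proof.
apply/subsetP => _ /imsetP[[x y] + ->]; rewrite !inE /= => /andP[xA yA]; rewrite cards2.
suff -> : x != y by [].
by apply: contraNneq yA => <-.
Qed.

Lemma bipartite_half_sides n (u v : 'I_n) : adj (bipartite_half n) u v ->
  (u < n./2)%N = ~~ (v < n./2)%N.
Proof.
case/imsetP=> -[x y]; rewrite !inE /= => /andP[xA yA] h.
have hx : x \in [set u; v] by rewrite h !inE eqxx.
have hy : y \in [set u; v] by rewrite h !inE eqxx orbT.
have hu : u \in [set x; y] by rewrite -h !inE eqxx.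
have hv : v \in [set x; y] by rewrite -h !inE eqxx orbT.
move: hx hy hu hv xA yA; rewrite !inE; clear.
case/orP => /eqP->; case/orP => /eqP->; rewrite ?eqxx ?orbb ?orbT //=.
- by move=> _ _ ->.
- by move=> _ _ -> /negbTE->.
- by move=> _ _ -> /negbTE->.
- by move=> _ _ ->.
Qed.

Lemma bipartite_half_no_odd_cycle n l : odd l -> ~ contains_copy (C_graph l) (bipartite_half n).
Proof.
move=> lo [f [_ fC]]; have l0 : (0 < l)%N by case: l lo {f fC}.
pose i0 := Ordinal l0; pose side i := (f i < n./2)%N.
have step i : side (ordS i) = ~~ side i.
  rewrite /side (@bipartite_half_sides n (f i) (f (ordS i))) ?negbK //.
  have := fC [set i; ordS i] (imset_f _ (erefl true)).
  by rewrite imsetU !imset_set1.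
have it m : side (iter m (@ordS l) i0) = odd m (+) side i0.
  by elim: m => //= m IH; rewrite step IH addNb.
have := it l; have -> : iter l (@ordS l) i0 = i0.
  by apply: val_inj; rewrite val_iter_ordS /= add0n modnn.
by rewrite lo; case: (side i0).
Qed.

Lemma card_half n : #|[set i : 'I_n | (i < n./2)%N]| = n./2.
Proof.
have h : (n./2 <= n)%N by rewrite -{2}(odd_double_half n) -addnn addnA leq_addl.
rewrite -sum1_card -[RHS]card_ord -sum1_card.
rewrite (big_ord_widen _ (fun=> 1%N) h); by apply: eq_bigl => i; rewrite inE.
Qed.

(** The [n./2 * (n - n./2)] edges are at least half of ['C(n, 2)] for every [n]; this is where
    [d <= 1/2] enters. *)
Lemma bipartite_half_density n (d : R) : d <= 2^-1 -> density_at_least (bipartite_half n) d.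
Proof.
move=> d1; rewrite /density_at_least.
have cB : #|bipartite_half n| = (n./2 * (n - n./2))%N.
  rewrite card_in_imset; last first.
    move=> [x y] [x' y']; rewrite !inE /= => /andP[xA yA] /andP[xA' yA'] h.
    have hx : x \in [set x'; y'] by rewrite -h !inE eqxx.
    have hy : y \in [set x'; y'] by rewrite -h !inE eqxx orbT.
    move: hx hy; rewrite !inE => /orP[] /eqP ex; last by rewrite ex (negbTE yA') in xA.
    by case/orP => /eqP ey; [rewrite ey xA' in yA|rewrite ex ey].
  by rewrite cardsX [X in (_ * X)%N]cardsCs setCK card_half card_ord.
have hC : ('C(n, 2) <= 2 * (n./2 * (n - n./2)))%N.
  have nE := odd_double_half n; have bE := mul2_bin2 n; move: bE nE.
  move: 'C(n, 2) (n./2) => b m bE; rewrite -(leq_pmul2l (isT : 0 < 2)%N) bE -mul2n.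
  case: (odd n) => nE.
    have -> : (n - m = m.+1)%N by move: nE; clear; lia.
    have -> : n.-1 = (2 * m)%N by move: nE; clear; lia.
    by rewrite -nE; clear; nia.
  have -> : (n - m = m)%N by move: nE; clear; lia.
  have : (n.-1 <= 2 * m)%N by move: nE; clear; lia.
  by move: (n.-1) => q; rewrite -nE; clear; nia.
apply: (@le_trans _ _ (2^-1 * 'C(n, 2)%:R)); first by rewrite ler_wpM2r.
rewrite cB; move: hC; rewrite -(ler_nat R) [(2 * _)%:R]natrM; lra.
Qed.

Lemma K_copy_expectation t n (p : R) : 0 <= p -> p <= 1 ->
  Pr p (edges_of n) (contains_copy (K_graph t)) <= n%:R ^+ t * p ^+ 'C(t, 2).
Proof.
move=> p0 p1.
apply: (@le_trans _ _ (Pr p (edges_of n) (fun E => exists2 f : {ffun 'I_t -> 'I_n},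
   injectiveb f & copy (K_graph t) f \subset E))).
  apply: Pr_le => // E EU [f [fi fE]]; exists (finfun f).
    by apply/injectiveP => i j; rewrite !ffunE; apply: fi.
  apply/subsetP => _ /imsetP[e eK ->]; rewrite (eq_imset (g := f)); first exact: fE.
  by move=> i; rewrite ffunE.
apply: le_trans (Pr_exists p0 p1 _ _ _) _.
apply: (@le_trans _ _ (\sum_(f : {ffun 'I_t -> 'I_n}) p ^+ 'C(t, 2))); last first.
  by rewrite sumr_const card_ffun !card_ord -[leLHS]mulr_natl natrX.
rewrite big_mkcond; apply: ler_sum => f _; case: ifP => [/injectiveP fi|_]; last exact: exprn_ge0.
have KE := @K_graph_is_graph t.
rewrite -[X in p ^+ X](_ : #|copy (K_graph t) f| = _); last first.
  by rewrite card_copy // card_draws card_ord.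
rewrite -(Ex_sup p (copy_sub KE fi)); apply: le_Ex => // E _.
by case: asboolP => // ->.
Qed.

(** The bound [n^t p^'C(t, 2)] on the expectation has square [L^t], which is at most [L] as
    [L <= 1]. *)
Lemma not_ramsey_whp t l n (p : R) : (4 <= t)%N -> odd l -> 0 <= p -> p <= 1 -> scale t n p <= 1 ->
  Pr p (edges_of n) (fun E => is_Ramsey (K_graph t) (C_graph l) (bipartite_half n :|: E)) <= scale t n p.
Proof.
move=> t4 lo p0 p1 s1.
apply: (@le_trans _ _ (n%:R ^+ t * p ^+ 'C(t, 2))).
  apply: le_trans (K_copy_expectation t n p0 p1); apply: Pr_le => // E EU ram.
  have [|[f [fi fR]]|[f [fi fB]]] := ram (E :\: bipartite_half n).
  - exact: subset_trans (subsetDl _ _) (subsetUr _ _).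
  - by exists f; split=> // e /fR; rewrite inE => /andP[].
  - exfalso; apply: (@bipartite_half_no_odd_cycle n l lo); exists f; split=> // e /fB.
    by rewrite !inE; case: (f @: e \in bipartite_half n) => //=; case: (f @: e \in E).
apply: ler_of_sqr; first exact: sqrtr_ge0.
have L0 : 0 <= n%:R ^+ 2 * p ^+ t.-1 by rewrite mulr_ge0 ?exprn_ge0.
have L1 : n%:R ^+ 2 * p ^+ t.-1 <= 1.
  by rewrite -(sqr_sqrtr L0) exprn_ile1 ?sqrtr_ge0.
rewrite /scale sqr_sqrtr // exprMn -!exprM ![(_ * 2)%N]mulnC mul2_bin2 exprM mulnC exprM -exprMn.
rewrite -[leRHS]expr1; apply: ler_wiXn2l => //; move: t4; clear; lia.
Qed.

End LowerBound.

(** * From the ratio of [p] to the threshold function to the scale *)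

Lemma scale_sqrE (R : realType) (t n : nat) (p : R) : (4 <= t)%N -> (0 < n)%N -> 0 <= p ->
  scale t n p ^+ 2 = (p / n%:R `^ (- (2 / t.-1%:R))) ^+ t.-1.
Proof.
move=> t4 n0 p0; rewrite /scale sqr_sqrtr; last by rewrite mulr_ge0 ?exprn_ge0.
have t1 : (t.-1%:R : R) != 0 by rewrite pnatr_eq0; case: t t4 => [|[]].
have n1 : (n%:R : R) != 0 by rewrite pnatr_eq0 -lt0n.
have hf : (n%:R `^ (- (2 / t.-1%:R)) : R) ^+ t.-1 = (n%:R ^+ 2)^-1.
  rewrite -powR_mulrn ?powR_ge0 // -powRrM mulNr mulfVK // powRN.
  by rewrite (powR_mulrn 2 (ler0n R n)).
by rewrite expr_div_n hf invrK mulrC.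
Qed.

Local Open Scope classical_set_scope.

Theorem theorem1p12 (R : realType) (t l : nat) (d : R) :
  (4 <= t)%N -> odd l -> (5 <= l)%N -> 0 < d -> d <= 2^-1 ->
  perturbed_Ramsey_threshold (K_graph t) (C_graph l) d
    (fun n : nat => (n%:R : R) `^ (- (2 / (t.-1)%:R))).
Proof.
move=> t4 lo l5 d0 d1; have t1 : (0 < t.-1)%N by case: t t4 => [|[]].
split=> p p01 pf.
  move=> Gs GsE Gsd; apply/cvgrPdist_le => e e0.
  have [S S1 hS] := ramsey_whp t4 lo l5 d0 d1 e0.
  near=> n; have [p0 p1] := andP (p01 n).
  have n0 : (0 < n)%N by near: n; exists 1%N.
  (* The ratio is at least [S^2 >= 1], so its power [t - 1], the square of the scale, is at least
     [S^2] too. *)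
  have ratio : S ^+ 2 <= p n / n%:R `^ (- (2 / t.-1%:R)).
    near: n; exact: (cvgryPge _).1 pf (S ^+ 2).
  have SL : S <= scale t n (p n).
    apply: ler_of_sqr; first exact: sqrtr_ge0.
    rewrite scale_sqrE //; apply: (le_trans ratio).
    rewrite -[leLHS]expr1; apply: ler_weXn2l => //.
    by apply: le_trans ratio; apply: exprn_ege1.
  rewrite Gnp_probE; have := hS n (p n) (Gs n) p0 p1 (GsE n) (Gsd n) SL.
  by rewrite PrC // ger0_norm // subr_ge0 Pr_le1.
exists (@bipartite_half); split; first exact: bipartite_half_graph.
split; first by move=> n; apply: bipartite_half_density.
apply/cvgrPdist_le => e e0.
(* The bound 1 is required by [not_ramsey_whp], and also makes the power [t - 1] of the ratio no
   larger than the ratio. *)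
pose m := Num.min 1 e.
have m0 : 0 < m by rewrite lt_min ltr01.
have m1 : m <= 1 by rewrite ge_min lexx.
near=> n; have [p0 p1] := andP (p01 n).
have n0 : (0 < n)%N by near: n; exists 1%N.
have ratio : `|p n / n%:R `^ (- (2 / t.-1%:R))| <= m ^+ 2.
  near: n; exact: (cvgr0Pnorm_le _).1 pf _ (exprn_gt0 2 m0).
have r0 : 0 <= p n / n%:R `^ (- (2 / t.-1%:R)) by rewrite divr_ge0 ?powR_ge0.
rewrite ger0_norm // in ratio.
have sm : scale t n (p n) <= m.
  apply: ler_of_sqr; first exact: ltW.
  rewrite scale_sqrE //; refine (le_trans _ ratio).
  rewrite -[leRHS]expr1; apply: ler_wiXn2l => //.
  by apply: (le_trans ratio); rewrite exprn_ile1 // ltW.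
rewrite Gnp_probE PrC // opprB addrC subrK.
rewrite ger0_norm ?Pr_ge0 //.
apply: le_trans (not_ramsey_whp t4 lo p0 p1 (le_trans sm m1)) _.
by apply: (le_trans sm); rewrite ge_min lexx orbT.
Unshelve. all: by end_near.
Qed.
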